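(* Let $P(z)=a_nz^n+\sum_{\nu=\mu}^{n}a_{n-\nu}z^{n-\nu}$, where $1\leq\mu\leq n$, be a polynomial (with complex coefficients) of degree $n$ having all its zeros in $|z|\leq k$, where $k\leq 1$. Then for every real or complex number $\alpha$ with $|\alpha|\geq k^\mu$ and for all $r>0$, $p>1$, $q>1$ with $p^{-1}+q^{-1}=1$, $$n(|\alpha|-k^\mu)\left\{\int_{0}^{2\pi}|P(e^{i\theta})|^r d\theta\right\}^{\frac{1}{r}}\leq\left\{\int_{0}^{2\pi}|1+k^\mu e^{i\theta}|^{pr}d\theta\right\}^{\frac{1}{pr}}\left\{\int_{0}^{2\pi}|D_\alpha P(e^{i\theta})|^{qr}d\theta\right\}^{\frac{1}{qr}}.$$
   Context: For a polynomial $P(z)$ of degree $n$ and a complex number $\alpha$, the polar derivative of $P$ with respect to $\alpha$ is $D_\alpha P(z)=nP(z)+(\alpha-z)P'(z)$. *)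

(* Defs.v *)
From mathcomp Require Import all_boot all_order all_algebra.
From mathcomp Require Import complex.
From mathcomp Require Import all_classical all_reals all_analysis.

Set Implicit Arguments.
Unset Strict Implicit.
Unset Printing Implicit Defensive.

Import Order.TTheory GRing.Theory Num.Theory.
Import ComplexField.Normc.

Local Open Scope ring_scope.

(* D_alpha P, with n = deg P = (size P).-1. *)
Definition polar_deriv (R : rcfType) (alpha : R[i]) (P : {poly R[i]}) :
  {poly R[i]} :=
  P *+ (size P).-1 + (alpha%:P - 'X) * P^`().

Definition expi (R : realType) (t : R) : R[i] := (cos t +i* sin t)%C.

(* (\int_0^{2 pi} |f(e^{it})|^s dt)^{1/s}: no 1/(2 pi) normalization. *)
Definition circle_norm (R : realType) (s : R) (f : R[i] -> R[i]) : R :=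
  (\int[@lebesgue_measure R]_(t in `[0%R, 2 * pi]) (normc (f (expi t)) `^ s))
    `^ s^-1.

(* Main.v *)
(* Let Q(z) = z^n conj(P(1 / conj z)), A = z Q' and B = n Q - z Q', so that
   A + B = n Q and, on the unit circle, |Q| = |P|, |B| = |P'| and
   |A| = |n P - z P'|.  Writing B / Q as a sum of terms 1 / (1 - conj(b) z) over
   the zeros b of P shows that Re (B / Q) >= n / 2, hence |A| <= |B| and B <> 0,
   wherever k |z| < 1.  As A vanishes to order mu at 0, Schwarz' lemma improves
   this to |A| <= (k |z|)^mu |B|.  On the circle this gives
   |D_alpha P| >= (|alpha| - k^mu) |P'|.  Moreover n Q / B = 1 + A / B is
   subordinate to 1 + k^mu z, so its L^(pr) norm is at most that of 1 + k^mu z,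
   and Hoelder's inequality applied to n |Q| = |1 + A / B| |B| concludes.

   Complex analysis is replaced by polynomial approximation: 1 / B is a uniform
   limit of polynomials on the closed disk, the maximum principle follows from
   Parseval's bound on the coefficients of powers, and Littlewood subordination
   from orthogonality together with the approximation of |1 + z|^s by |G(z)|^2,
   G a truncated binomial series of (1 + z)^(s/2). *)

Require Import Defs.
From mathcomp Require Import all_boot all_order all_algebra.
From mathcomp Require Import complex.
From mathcomp Require Import ring lra zify.
From mathcomp Require Import all_classical all_reals all_analysis.
Set Implicit Arguments.
Unset Strict Implicit.
Unset Printing Implicit Defensive.
Import Order.TTheory GRing.Theory Num.Theory.
Import numFieldNormedType.Exports.
Import ComplexField.Normc.
Local Open Scope ring_scope.
Local Open Scope classical_set_scope.

Local Notation Re := complex.Re.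
Local Notation Im := complex.Im.

(** * The modulus of a complex number *)

Lemma normc_ge0 (R : rcfType) (x : R[i]) : 0 <= normc x.
Proof. by case: x => a b; exact: sqrtr_ge0. Qed.

Lemma sqr_normcE (R : rcfType) (x : R[i]) :
  normc x ^+ 2 = Re x ^+ 2 + Im x ^+ 2.
Proof. by case: x => a b /=; rewrite sqr_sqrtr// addr_ge0 ?sqr_ge0. Qed.

Lemma normcX (R : rcfType) (x : R[i]) n : normc (x ^+ n) = normc x ^+ n.
Proof.
by elim: n => [|n ih]; rewrite ?expr0 ?normc1// !exprS normcM ih.
Qed.

Lemma normc_real (R : rcfType) (x : R) : normc x%:C%C = `|x|.
Proof. by rewrite /= expr0n addr0 sqrtr_sqr. Qed.

Lemma normc_nat (R : rcfType) (n : nat) : normc (n%:R : R[i]) = n%:R.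
Proof.
by rewrite -(rmorph_nat (real_complex R)) normc_real ger0_norm.
Qed.

Lemma normc_conj (R : rcfType) (x : R[i]) : normc (x^*)%C = normc x.
Proof. by case: x => a b /=; rewrite sqrrN. Qed.

Lemma normc_eq0 (R : rcfType) (x : R[i]) : (normc x == 0) = (x == 0).
Proof.
by apply/eqP/eqP => [/eq0_normc //|->]; rewrite normc0.
Qed.

Lemma normc_gt0 (R : rcfType) (x : R[i]) : (0 < normc x) = (x != 0).
Proof. by rewrite lt0r normc_eq0 normc_ge0 andbT. Qed.

Lemma le_normcB (R : rcfType) (x y : R[i]) :
  normc (x - y) <= normc x + normc y.
Proof. by rewrite -(normcN y) le_normcD. Qed.

Lemma le_normc_sub (R : rcfType) (x y : R[i]) :
  normc x - normc y <= normc (x - y).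
Proof. by rewrite lerBlDr (le_trans _ (le_normcD _ _))// subrK. Qed.

Lemma ler_dist_normc (R : rcfType) (x y : R[i]) :
  `|normc x - normc y| <= normc (x - y).
Proof.
rewrite ler_norml le_normc_sub andbT lerNl opprB -(normcN (x - y)) opprB.
exact: le_normc_sub.
Qed.

Lemma le_normc_sum (R : rcfType) (I : Type) (s : seq I) (P : pred I)
    (F : I -> R[i]) :
  normc (\sum_(i <- s | P i) F i) <= \sum_(i <- s | P i) normc (F i).
Proof.
elim/big_rec2 : _ => [|i x y _ xy]; first by rewrite normc0.
by rewrite (le_trans (le_normcD _ _))// lerD2l.
Qed.

Lemma normr_Re_le (R : rcfType) (x : R[i]) : `|Re x| <= normc x.
Proof.
by case: x => a b /=; rewrite -sqrtr_sqr ler_wsqrtr// lerDl sqr_ge0.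
Qed.

Lemma cReM (R : rcfType) (x y : R[i]) : Re (x * y) = Re x * Re y - Im x * Im y.
Proof. by case: x y => a b [c d]. Qed.

Lemma cImM (R : rcfType) (x y : R[i]) : Im (x * y) = Re x * Im y + Im x * Re y.
Proof. by case: x y => a b [c d]. Qed.

Lemma cReD (R : rcfType) (x y : R[i]) : Re (x + y) = Re x + Re y.
Proof. by case: x y => a b [c d]. Qed.

Lemma cImD (R : rcfType) (x y : R[i]) : Im (x + y) = Im x + Im y.
Proof. by case: x y => a b [c d]. Qed.

Lemma sqr_normcD (R : rcfType) (x y : R[i]) :
  normc (x + y) ^+ 2
  = normc x ^+ 2 + normc y ^+ 2 + 2 * Re (x^*%C * y).
Proof. by rewrite !sqr_normcE; case: x y => a b [c d] /=; ring. Qed.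

Lemma normc_expi (R : realType) (t : R) : normc (expi t) = 1.
Proof. by rewrite /= cos2Dsin2 sqrtr1. Qed.

Lemma mulc_conj_unit (R : realType) (z : R[i]) : normc z = 1 -> z * z^*%C = 1.
Proof.
move=> z1; have := sqr_normcE z; rewrite z1 expr1n.
case: z {z1} => a b /= h; apply/eqP; rewrite eq_complex /=.
by apply/andP; split; apply/eqP; [rewrite mulrN opprK -!expr2|ring].
Qed.

(** * Complex-valued functions of a real variable *)

(** Continuity, and differentiability below, are stated on real and imaginary parts, so that
    calculus of real functions applies. *)
Definition ccont (R : realType) (f : R -> R[i]) :=
  continuous (fun t => Re (f t)) /\ continuous (fun t => Im (f t)).

Definition cderiv (R : realType) (f : R -> R[i]) (t : R) (d : R[i]) :=
  is_derive t 1 (fun t => Re (f t)) (Re d)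
  /\ is_derive t 1 (fun t => Im (f t)) (Im d).

Lemma cont_mul (R : realType) (f g : R -> R) :
  continuous f -> continuous g -> continuous (fun t => f t * g t).
Proof. by move=> cf cg t; apply: cvgM; [exact: cf|exact: cg]. Qed.

Lemma cont_add (R : realType) (f g : R -> R) :
  continuous f -> continuous g -> continuous (fun t => f t + g t).
Proof. by move=> cf cg t; apply: cvgD; [exact: cf|exact: cg]. Qed.

Lemma cont_opp (R : realType) (f : R -> R) :
  continuous f -> continuous (fun t => - f t).
Proof. by move=> cf t; apply: cvgN; exact: cf. Qed.

Lemma ccont_cst (R : realType) (c : R[i]) : ccont (fun=> c).
Proof. by split => t; exact: cvg_cst. Qed.

Lemma ccontD (R : realType) (f g : R -> R[i]) :
  ccont f -> ccont g -> ccont (fun t => f t + g t).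
Proof.
move=> [f1 f2] [g1 g2]; split.
- by under eq_fun do rewrite cReD; exact: cont_add.
- by under eq_fun do rewrite cImD; exact: cont_add.
Qed.

Lemma ccontM (R : realType) (f g : R -> R[i]) :
  ccont f -> ccont g -> ccont (fun t => f t * g t).
Proof.
move=> [f1 f2] [g1 g2]; split.
- under eq_fun do rewrite cReM.
  by apply: cont_add; [|apply: cont_opp]; exact: cont_mul.
- by under eq_fun do rewrite cImM; apply: cont_add; exact: cont_mul.
Qed.

Lemma ccont_horner (R : realType) (p : {poly R[i]}) (f : R -> R[i]) :
  ccont f -> ccont (fun t => p.[f t]).
Proof.
move=> cf; elim/poly_ind: p => [|p c ih].
  by under eq_fun do rewrite horner0; exact: ccont_cst.
under eq_fun do rewrite hornerMXaddC.
by apply: ccontD; [exact: ccontM|exact: ccont_cst].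
Qed.

Lemma ccont_expi (R : realType) : ccont (@expi R).
Proof. by split=> t; [exact: continuous_cos|exact: continuous_sin]. Qed.

Lemma ccont_line (R : realType) (z : R[i]) : ccont (fun t => t%:C%C * z).
Proof.
apply: ccontM; last exact: ccont_cst.
by split=> t /=; [exact: cvg_id|exact: cvg_cst].
Qed.

Lemma cont_normc (R : realType) (f : R -> R[i]) :
  ccont f -> continuous (fun t => normc (f t)).
Proof.
move=> [f1 f2].
rewrite (_ : (fun t => _)
    = (fun t => Num.sqrt (Re (f t) * Re (f t) + Im (f t) * Im (f t)))); last first.
  by apply/funext => t; case: (f t) => a b /=; rewrite !expr2.
move=> t; apply: continuous_comp; last exact: sqrt_continuous.
by apply: (cont_add (cont_mul f1 f1) (cont_mul f2 f2)).
Qed.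

Lemma cderiv_cst (R : realType) (c : R[i]) t : cderiv (fun=> c) t 0.
Proof. by split => /=; exact: is_derive_cst. Qed.

Lemma cderivD (R : realType) (f g : R -> R[i]) t df dg :
  cderiv f t df -> cderiv g t dg -> cderiv (fun t => f t + g t) t (df + dg).
Proof.
move=> [f1 f2] [g1 g2]; split.
- by under eq_fun do rewrite cReD; rewrite cReD; exact: is_deriveD.
- by under eq_fun do rewrite cImD; rewrite cImD; exact: is_deriveD.
Qed.

Lemma is_derive_mul (R : realType) (f g : R -> R) (t df dg : R) :
  is_derive t 1 f df -> is_derive t 1 g dg ->
  is_derive t 1 (fun t => f t * g t) (df * g t + f t * dg).
Proof.
move=> f1 g1; apply: (@is_derive_eq _ _ _ _ _ _ _ _ (is_deriveM f1 g1)).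
by rewrite addrC mulrC.
Qed.

Lemma cderivM (R : realType) (f g : R -> R[i]) t df dg :
  cderiv f t df -> cderiv g t dg ->
  cderiv (fun t => f t * g t) t (df * g t + f t * dg).
Proof.
move=> [f1 f2] [g1 g2]; split.
- under eq_fun do rewrite cReM; rewrite cReD !cReM addrACA -opprD.
  by apply: is_deriveB; exact: is_derive_mul.
- under eq_fun do rewrite cImM; rewrite cImD !cImM.
  rewrite addrACA (addrC (Im df * _)) addrACA [X in _ + X]addrC.
  rewrite [X in is_derive _ _ _ X](_ : _ =
    (Re df * Im (g t) + Re (f t) * Im dg) + (Im df * Re (g t) + Im (f t) * Re dg));
    last by ring.
  by apply: is_deriveD; exact: is_derive_mul.
Qed.

Lemma cderiv_eq (R : realType) (f : R -> R[i]) t d d' :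
  cderiv f t d -> d = d' -> cderiv f t d'.
Proof. by move=> ? <-. Qed.

Lemma cderiv_horner (R : realType) (p : {poly R[i]}) (f : R -> R[i]) t df :
  cderiv f t df -> cderiv (fun t => p.[f t]) t (p^`().[f t] * df).
Proof.
move=> cf; elim/poly_ind: p => [|p c ih].
  under eq_fun do rewrite horner0.
  by rewrite deriv0 horner0 mul0r; exact: cderiv_cst.
under eq_fun do rewrite hornerMXaddC.
rewrite derivD derivM derivX derivC addr0 mulr1 hornerD hornerMX.
apply: (cderiv_eq (cderivD (cderivM ih cf) (cderiv_cst c t))).
by rewrite addr0; ring.
Qed.

Lemma cderiv_expi (R : realType) (t : R) : cderiv (@expi R) t ('i%C * expi t).
Proof.
split => /=; first by rewrite mul0r mul1r sub0r; exact: is_derive_cos.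
by rewrite mul0r mul1r add0r; exact: is_derive_sin.
Qed.

Lemma cderiv_line (R : realType) (z : R[i]) t :
  cderiv (fun t => t%:C%C * z) t z.
Proof.
have h : cderiv (fun t : R => t%:C%C) t 1.
  by split => /=; [exact: is_derive_id|exact: is_derive_cst].
apply: (cderiv_eq (cderivM h (cderiv_cst z t))).
by rewrite mulr0 addr0 mul1r.
Qed.

(** * Integrals over the circle *)

Definition cint (R : realType) (f : R -> R) : R :=
  \int[@lebesgue_measure R]_(t in `[0%R, 2 * pi]) f t.

Lemma twopi_gt0 (R : realType) : 0 < 2 * pi :> R.
Proof. by rewrite mulr_gt0// pi_gt0. Qed.

Lemma cont_integrable (R : realType) (f : R -> R) : continuous f ->
  (@lebesgue_measure R).-integrable `[0%R, 2 * pi] (EFin \o f).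
Proof.
move=> cf; apply: continuous_compact_integrable; first exact: segment_compact.
exact: continuous_subspaceT.
Qed.

Lemma cintD (R : realType) (f g : R -> R) : continuous f -> continuous g ->
  cint (fun t => f t + g t) = cint f + cint g.
Proof. by move=> cf cg; rewrite /cint RintegralD//; exact: cont_integrable. Qed.

Lemma cintZ (R : realType) (f : R -> R) c : continuous f ->
  cint (fun t => c * f t) = c * cint f.
Proof. by move=> cf; rewrite /cint RintegralZl//; exact: cont_integrable. Qed.

Lemma le_cint (R : realType) (f g : R -> R) : continuous f -> continuous g ->
  (forall t, f t <= g t) -> cint f <= cint g.
Proof.
by move=> cf cg fg; apply: le_Rintegral => //; exact: cont_integrable.
Qed.

Lemma cint_ge0 (R : realType) (f : R -> R) :
  (forall t, 0 <= f t) -> 0 <= cint f.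
Proof. by move=> f0; apply: Rintegral_ge0. Qed.

Lemma cint_cst (R : realType) (c : R) : cint (fun=> c) = 2 * pi * c.
Proof.
rewrite /cint Rintegral_cst//= lebesgue_measure_itv/= lte_fin twopi_gt0.
by rewrite /= subr0 mulrC.
Qed.

Lemma eq_cint (R : realType) (f g : R -> R) : f =1 g -> cint f = cint g.
Proof. by move=> fg; apply: eq_Rintegral => t _; exact: fg. Qed.

Lemma cint_derive (R : realType) (F f : R -> R) : continuous f ->
  (forall t : R, is_derive t 1 F (f t)) -> cint f = F (2 * pi) - F 0.
Proof.
move=> cf dF; have cF : continuous F.
  by move=> t; apply/differentiable_continuous/derivable1_diffP; apply: ex_derive.
rewrite /cint /Rintegral (@continuous_FTC2 _ _ F)//.
- exact: twopi_gt0.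
- exact: continuous_subspaceT.
- split => [t _||]; first exact: ex_derive.
  + exact/cvg_at_right_filter/cF.
  + exact/cvg_at_left_filter/cF.
- by move=> t _; rewrite derive1E; apply: derive_val.
Qed.

(** Write $p - p_0 = z q'$. Along the circle $q(e^{it})$ has derivative $i z q'$, so $\Re(z q')$ is
    the derivative of $\Im q(e^{it})$, which agrees at $0$ and $2\pi$. *)
Lemma mean_value (R : realType) (p : {poly R[i]}) :
  cint (fun t => Re p.[expi t]) = 2 * pi * Re p`_0.
Proof.
(* At index 0 the division by zero yields 0, an arbitrary choice of integration constant. *)
pose q : {poly R[i]} := \poly_(i < size p) (p`_i / i%:R).
have qE : 'X * q^`() = p - (p`_0)%:P.
  apply/polyP => -[|i]; rewrite coefXM coefB coefC /=; first by rewrite subrr.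
  rewrite subr0 coef_deriv coef_poly; case: ltnP => h.
    by rewrite -(mulr_natr (p`_i.+1 / i.+1%:R)) divfK// pnatr_eq0.
  by rewrite mul0rn nth_default.
have pE : p = 'X * q^`() + (p`_0)%:P by rewrite qE subrK.
have cp t : cderiv (fun t => q.[expi t]) t ('i%C * ('X * q^`()).[expi t]).
  apply: (cderiv_eq (cderiv_horner q (cderiv_expi t))).
  by rewrite hornerM hornerX; ring.
have -> : cint (fun t => Re p.[expi t])
  = cint (fun t => Re ('X * q^`()).[expi t] + Re p`_0).
  by apply: eq_cint => t; rewrite {1}pE hornerD hornerC cReD.
have c1 : continuous (fun t => Re ('X * q^`()).[expi t]).
  by case: (ccont_horner ('X * q^`()) (ccont_expi R)).
rewrite cintD//; last by move=> t; exact: cvg_cst.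
rewrite cint_cst [X in X + _](_ : _ = Im q.[expi (2 * pi)] - Im q.[expi 0]); last first.
  apply: (@cint_derive _ (fun t => Im q.[expi t])) => // t; case: (cp t) => _ h; apply: (is_derive_eq h).
  by rewrite cImM /=; lra.
have -> : expi (2 * pi) = expi 0 :> R[i].
  by rewrite /expi mulr_natl cos2pi sin2pi cos0 sin0.
by rewrite subrr add0r.
Qed.

(** * The maximum principle for rational functions *)

Lemma cont_sqr_normc_horner (R : realType) (p : {poly R[i]}) (f : R -> R[i]) :
  ccont f -> continuous (fun t => normc p.[f t] ^+ 2).
Proof.
by move=> /(ccont_horner p)/cont_normc cp; exact: (cont_mul cp cp).
Qed.

(** Pythagoras: the cross term $2\Re(\bar c q)$ is the real part of a polynomial without constant
    term, so its integral vanishes. *)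
Lemma cint_sqr_normcD (R : realType) (c : R[i]) (q : {poly R[i]}) :
  q`_0 = 0 ->
  cint (fun t => normc (c + q.[expi t]) ^+ 2)
  = 2 * pi * normc c ^+ 2 + cint (fun t => normc q.[expi t] ^+ 2).
Proof.
move=> q0; pose h := (2 * c^*%C) *: q.
have hE t : Re h.[expi t] = 2 * Re (c^*%C * q.[expi t]).
  have -> : h.[expi t] = 2%:R%:C%C * (c^*%C * q.[expi t]).
    by rewrite hornerZ mulrA rmorph_nat.
  by rewrite cReM /= mul0r subr0.
have cq : continuous (fun t => normc q.[expi t] ^+ 2).
  exact/cont_sqr_normc_horner/ccont_expi.
have ch : continuous (fun t => Re h.[expi t]).
  by case: (ccont_horner h (ccont_expi R)).
rewrite (@eq_cint _ _ (fun t => normc c ^+ 2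
    + (normc q.[expi t] ^+ 2 + Re h.[expi t]))); last first.
  by move=> t; rewrite sqr_normcD hE addrA.
have c0 : continuous (fun _ : R => normc c ^+ 2) by move=> t; exact: cvg_cst.
rewrite cintD//; last exact: cont_add.
by rewrite cint_cst cintD// mean_value coefZ q0 mulr0 mulr0 addr0.
Qed.

(* Peeling off the constant term of [g] leaves [W * (g1 \Po W)], which is
   orthogonal to the constants, and multiplication by [W] contracts by [tau]. *)
Lemma cint_sqr_comp_le (R : realType) (W g : {poly R[i]}) (tau : R) :
  W`_0 = 0 -> 0 <= tau -> (forall t, normc W.[expi t] <= tau) ->
  cint (fun t => normc g.[W.[expi t]] ^+ 2)
  <= cint (fun t => normc g.[tau%:C%C * expi t] ^+ 2).
Proof.
move=> W0 tau0 Wtau; elim/poly_ind: g => [|g c ih].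
  by rewrite le_eqVlt; apply/orP; left; apply/eqP/eq_cint => t; rewrite !horner0.
rewrite (@eq_cint _ _ (fun t => normc (c + ((g \Po W) * W).[expi t]) ^+ 2));
  last first.
  by move=> t; rewrite hornerMXaddC hornerM horner_comp addrC.
pose T : {poly R[i]} := tau%:C%C *: 'X.
have TE t : T.[expi t] = tau%:C%C * expi t by rewrite hornerZ hornerX.
rewrite [leRHS](@eq_cint _ _ (fun t => normc (c + ((g \Po T) * T).[expi t]) ^+ 2));
  last first.
  by move=> t; rewrite hornerMXaddC hornerM horner_comp TE addrC.
have ce := ccont_expi R.
rewrite !cint_sqr_normcD ?coef0M ?W0 ?coefZ ?coefX ?mulr0//.
rewrite lerD2l.
apply: (@le_trans _ _ (cint (fun t => tau ^+ 2 * normc (g \Po W).[expi t] ^+ 2))).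
  apply: le_cint; first exact: cont_sqr_normc_horner.
    apply: cont_mul; first by move=> t; exact: cvg_cst.
    exact: cont_sqr_normc_horner.
  move=> t; rewrite hornerM normcM exprMn mulrC ler_wpM2r ?sqr_ge0//.
  by rewrite ler_sqr ?nnegrE ?normc_ge0.
rewrite [leRHS](@eq_cint _ _ (fun t => tau ^+ 2 * normc g.[tau%:C%C * expi t] ^+ 2));
  last first.
  move=> t; rewrite hornerM horner_comp TE normcM exprMn mulrC; congr (_ * _).
  by rewrite normcM normc_expi mulr1 normc_real ger0_norm.
rewrite !cintZ; first last.
- exact: cont_sqr_normc_horner.
- by apply: cont_sqr_normc_horner; apply: ccontM => //; exact: ccont_cst.
rewrite ler_wpM2l ?sqr_ge0// (le_trans _ ih)//.
by rewrite (@eq_cint _ _ (fun t => normc g.[W.[expi t]] ^+ 2))// => t;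
  rewrite horner_comp.
Qed.

(** Parseval by peeling: the square integral of $c + z p$ is that of $c$ plus that of $p$, as $|z| =
    1$. Constant terms are discarded until the wanted coefficient becomes the constant one. *)
Lemma normc_coef_le (R : realType) (p : {poly R[i]}) (M : R) i :
  0 <= M -> (forall t, normc p.[expi t] <= M) -> normc p`_i <= M.
Proof.
move=> M0 pM.
have : cint (fun t => normc p.[expi t] ^+ 2) <= 2 * pi * M ^+ 2.
  rewrite -cint_cst; apply: le_cint.
  - exact/cont_sqr_normc_horner/ccont_expi.
  - by move=> t; exact: cvg_cst.
  - by move=> t; rewrite ler_sqr ?nnegrE ?normc_ge0.
elim: i p {pM} => [|i ih] p; elim/poly_ind: p => [|p c _];
  rewrite ?coef0 ?normc0//.
  rewrite (@eq_cint _ _ (fun t => normc (c + (p * 'X).[expi t]) ^+ 2)); last first.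
    by move=> t; rewrite hornerD hornerC addrC.
  rewrite cint_sqr_normcD ?coefMX// coefD coefMX coefC /= add0r => h.
  rewrite -ler_sqr ?nnegrE ?normc_ge0// -(ler_pM2l (twopi_gt0 R)).
  by rewrite (le_trans _ h)// lerDl; apply: cint_ge0 => t; exact: sqr_ge0.
rewrite (@eq_cint _ _ (fun t => normc (c + (p * 'X).[expi t]) ^+ 2)); last first.
  by move=> t; rewrite hornerD hornerC addrC.
rewrite cint_sqr_normcD ?coefMX// coefD coefMX coefC /= addr0 => h.
apply: ih; rewrite (le_trans _ h)//.
rewrite (@eq_cint _ (fun t => normc (p * 'X).[expi t] ^+ 2)
  (fun t => normc p.[expi t] ^+ 2)); last first.
  by move=> t; rewrite hornerMX normcM normc_expi mulr1.
by rewrite lerDr mulr_ge0 ?sqr_ge0// ltW// twopi_gt0.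
Qed.

(** Bernoulli's inequality makes the powers of any $x > 1$ unbounded. *)
Lemma le1_bounded_powers (R : realType) (x K : R) :
  (forall N, x ^+ N <= K) -> x <= 1.
Proof.
move=> xK; rewrite leNgt; apply/negP => x1.
have bern N : 1 + N%:R * (x - 1) <= x ^+ N.
  elim: N => [|N ih]; first by rewrite mul0r addr0 expr0.
  rewrite exprS -natr1; apply: (le_trans _ (ler_wpM2l _ ih)); last by lra.
  by have : 0 <= N%:R * (x - 1) ^+ 2 by [rewrite mulr_ge0// sqr_ge0]; nra.
(* This exponent exceeds $K/(x-1)$, so Bernoulli's lower bound already exceeds $K$. *)
have := xK (Num.truncn (K / (x - 1))).+1; apply/negP; rewrite -ltNge.
apply: (lt_le_trans _ (bern _)).
have : K / (x - 1) < (Num.truncn (K / (x - 1))).+1%:R by exact: truncnS_gt.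
by rewrite ltr_pdivrMr ?subr_gt0//; lra.
Qed.

(** Otherwise $x > 0$ and all powers of $1/x$ stay below $1/e$, which forces $1/x \le 1$. *)
Lemma small_power (R : realType) (x e : R) : 0 <= x -> x < 1 -> 0 < e ->
  exists J, x ^+ J <= e.
Proof.
move=> x0 x1 e0; have [->|xn0] := eqVneq x 0.
  by exists 1%N; rewrite expr1 ltW.
apply: contrapT => /forallNP h.
have xp : 0 < x by rewrite lt0r xn0.
suff : x^-1 <= 1 by rewrite invf_le1// leNgt x1.
apply: (@le1_bounded_powers _ _ e^-1) => N.
rewrite exprVn lef_pV2 ?posrE ?exprn_gt0//.
by have /negP := h N; rewrite -ltNge => /ltW.
Qed.

Lemma sum_geometric_le (R : realFieldType) (x : R) n : 0 <= x -> x < 1 ->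
  \sum_(i < n) x ^+ i <= (1 - x)^-1.
Proof.
move=> x0 x1; rewrite -[leRHS]mul1r ler_pdivlMr ?subr_gt0//.
set S := \sum_(i < _) _; rewrite -[S * _]opprK -mulrN opprB mulrC -subrX1 opprB.
by rewrite lerBlDr lerDl exprn_ge0.
Qed.

(** Power trick: the coefficients of $p^N$ are at most $M^N$, so $|p(u)|^N \le M^N/(1-|u|)$ inside
    the disk. The last factor does not depend on $N$, hence $|p(u)|/M$ has bounded powers. *)
Lemma poly_max_principle (R : realType) (p : {poly R[i]}) (M : R) (u : R[i]) :
  0 <= M -> (forall z, normc z = 1 -> normc p.[z] <= M) ->
  normc u <= 1 -> normc p.[u] <= M.
Proof.
move=> M0 pM; rewrite le_eqVlt => /predU1P[|u1]; first exact: pM.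
have [M00|Mn0] := eqVneq M 0.
  have p0 : p = 0.
    apply/polyP => i; rewrite coef0; apply/eq0_normc/le_anti.
    rewrite normc_ge0 andbT -M00; apply: normc_coef_le => // t.
    by rewrite pM// normc_expi.
  by rewrite p0 horner0 normc0.
have Mp : 0 < M by rewrite lt0r Mn0.
rewrite -[leRHS]mul1r -ler_pdivrMr//.
apply: (@le1_bounded_powers _ _ (1 - normc u)^-1) => N.
rewrite expr_div_n ler_pdivrMr ?exprn_gt0// -normcX -horner_exp mulrC.
rewrite horner_coef (le_trans (le_normc_sum _ _ _))//.
apply: (@le_trans _ _ (\sum_(i < size (p ^+ N)) M ^+ N * normc u ^+ i)).
  apply: ler_sum => i _; rewrite normcM normcX ler_wpM2r ?exprn_ge0 ?normc_ge0//.
  apply: normc_coef_le => [|t]; first exact: exprn_ge0.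
  by rewrite horner_exp normcX lerXn2r ?nnegrE ?normc_ge0// pM// normc_expi.
rewrite -mulr_sumr ler_wpM2l ?exprn_ge0//.
by rewrite sum_geometric_le ?normc_ge0.
Qed.

(** The zeros $b$ of $B$ lie outside the closed disk, so each factor $z - b$ is inverted up to a
    small error by a truncated geometric series in $z/b$. Induction over the zeros multiplies these
    approximate inverses. *)
Lemma poly_inverse_approx (R : realType) (B : {poly R[i]}) :
  (forall z, normc z <= 1 -> B.[z] != 0) ->
  forall e, 0 < e -> exists C : {poly R[i]},
    forall z, normc z <= 1 -> normc (1 - C.[z] * B.[z]) <= e.
Proof.
move=> Bn0; have Bneq0 : B != 0.
  by apply: contraNneq (Bn0 0 _) => [->|]; rewrite ?horner0 ?normc0 ?ler01.
have [s Bs] := closed_field_poly_normal B.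
have lB : lead_coef B != 0 by rewrite lead_coef_eq0.
suff h : forall e, 0 < e -> exists C : {poly R[i]}, forall z, normc z <= 1 ->
    normc (1 - C.[z] * (\prod_(b <- s) ('X - b%:P)).[z]) <= e.
  move=> e /h[C hC]; exists ((lead_coef B)^-1 *: C) => z /hC.
  by rewrite {2}Bs !hornerZ mulrACA mulVf// mul1r.
have sb b : b \in s -> 1 < normc b.
  move=> bs; rewrite ltNge; apply/negP => /Bn0; rewrite Bs hornerZ mulf_eq0.
  rewrite negb_or => /andP[_ /negP]; apply.
  by rewrite -[_ == 0]/(root _ b) root_prod_XsubC.
elim: s sb {Bs} => [_ e e0|b s ih sb e e0].
  by exists 1 => z _; rewrite big_nil hornerC mulr1 subrr normc0 ltW.
(* Two approximate inverses with errors at most $d$ multiply to one with error at most $2d + d^2$;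
   the cap at 1 makes this at most $3d \le e$. *)
pose d := Num.min e 1 / 3.
have d0 : 0 < d by rewrite divr_gt0// lt_min e0 ltr01.
have dd : d + d + d * d <= e.
  have : d <= e / 3 by rewrite ler_pM2r// ge_min lexx.
  have : d <= 1 / 3 by rewrite ler_pM2r// ge_min lexx orbT.
  by nra.
have [//|C hC] := ih _ d d0; first by move=> x xs; rewrite sb// inE xs orbT.
have b1 : 1 < normc b by rewrite sb// mem_head.
have bn0 : b != 0 by rewrite -normc_gt0 (lt_trans _ b1).
have [||J hJ] := @small_power _ (normc b)^-1 d _ _ d0.
- by rewrite invr_ge0 normc_ge0.
- by rewrite invf_lt1// (lt_trans _ b1).
(* The truncation of $1/(z-b) = -b^{-1}\sum_i (z/b)^i$; telescoping gives $D(z)(z-b) = 1 -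
   (z/b)^J$. *)
pose D : {poly R[i]} := - b^-1 *: \sum_(i < J) (b^-1 *: 'X) ^+ i.
exists (C * D) => z z1; rewrite big_cons !hornerM.
have DE : D.[z] * ('X - b%:P).[z] = 1 - (z / b) ^+ J.
  rewrite !hornerE horner_sum.
  under eq_bigr do rewrite horner_exp hornerZ hornerX mulrC.
  rewrite -[RHS]opprB subrX1; set S := \sum_(i < _) _.
  by field.
set c := C.[z]; set q := (\prod_(j <- s) _).[z].
rewrite (_ : c * D.[z] * _ = (c * q) * (D.[z] * ('X - b%:P).[z])); last by ring.
rewrite DE; have := hC _ z1; rewrite -/c -/q; set y := c * q => yd.
rewrite (_ : 1 - y * (1 - (z / b) ^+ J)
  = (1 - y) + (z / b) ^+ J - (1 - y) * (z / b) ^+ J); last by ring.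
have zJ : normc ((z / b) ^+ J) <= d.
  rewrite normcX (le_trans _ hJ)// normcM normcV lerXn2r ?nnegrE//.
  - by rewrite mulr_ge0 ?invr_ge0 ?normc_ge0.
  - by rewrite invr_ge0 normc_ge0.
  - by rewrite ler_piMl// invr_ge0 normc_ge0.
apply: (le_trans (le_normcB _ _)); apply: (le_trans _ dd); apply: lerD.
  by rewrite (le_trans (le_normcD _ _))// lerD.
by rewrite normcM ler_pM ?normc_ge0.
Qed.

(** If $b < a$, the choice $e = (a-b)/(2(a+b))$ would give $a - b \le (a-b)/2$. *)
Lemma ler_relative_eps (R : realFieldType) (a b : R) : 0 <= a -> 0 <= b ->
  (forall e, 0 < e -> a * (1 - e) <= b * (1 + e)) -> a <= b.
Proof.
move=> a0 b0 h; rewrite leNgt; apply/negP => ba.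
have ab : 0 < a + b by lra.
have /h : 0 < (a - b) / (2 * (a + b)) by rewrite divr_gt0; lra.
have : (a - b) / (2 * (a + b)) * (a + b) = (a - b) / 2 by field; lra.
by set e := _ / _; lra.
Qed.

(** With [C] close to $1/B$, the maximum principle for the polynomial $AC$ has bound $M(1+e)$, and
    $|CB| \ge 1 - e$ at [u] turns it back into a bound on $A$. *)
Lemma rational_max_principle (R : realType) (A B : {poly R[i]}) (M : R) u :
  (forall z, normc z <= 1 -> B.[z] != 0) -> 0 <= M ->
  (forall z, normc z = 1 -> normc A.[z] <= M * normc B.[z]) ->
  normc u <= 1 -> normc A.[u] <= M * normc B.[u].
Proof.
move=> Bn0 M0 AB u1.
apply: ler_relative_eps; rewrite ?mulr_ge0 ?normc_ge0// => e e0.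
have [C hC] := poly_inverse_approx Bn0 e0.
have CB z : normc z <= 1 -> normc (C.[z] * B.[z]) <= 1 + e.
  move=> /hC h; have -> : C.[z] * B.[z] = 1 - (1 - C.[z] * B.[z]) by ring.
  by rewrite (le_trans (le_normcB _ _))// normc1 lerD2l.
have CB' : 1 - e <= normc (C.[u] * B.[u]).
  have := le_normc_sub 1 (1 - C.[u] * B.[u]); rewrite normc1 subKr.
  by apply: le_trans; rewrite lerD2l lerN2 hC.
have h : normc (A * C).[u] <= M * (1 + e).
  apply: poly_max_principle => //; first by rewrite mulr_ge0//; lra.
  move=> z z1; rewrite hornerM normcM.
  apply: (@le_trans _ _ (M * normc B.[z] * normc C.[z])).
    by rewrite ler_wpM2r ?normc_ge0// AB.
  by rewrite -mulrA ler_wpM2l// mulrC -normcM CB// z1.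
apply: (@le_trans _ _ (normc A.[u] * normc (C.[u] * B.[u]))).
  by rewrite ler_wpM2l ?normc_ge0.
rewrite normcM mulrA -normcM -hornerM.
by rewrite [leRHS]mulrAC ler_wpM2r ?normc_ge0.
Qed.

(** * Limits of circle integrals *)

(** The absolute value extends the power to the whole line. Away from 0 the power is differentiable;
    at 0 the radius $e^{1/s}$ answers the tolerance $e$. *)
Lemma powR_norm_continuous (R : realType) (s : R) : 0 < s ->
  continuous (fun x : R => `|x| `^ s).
Proof.
move=> s0 x; have [->|xn0] := eqVneq x 0.
  rewrite /continuous_at normr0 powR0 ?gt_eqF//.
  apply/cvgrPdist_lt => e e0; near=> y.
  rewrite sub0r normrN ger0_norm ?powR_ge0//.
  have -> : e = (e `^ s^-1) `^ s by rewrite -powRrM mulVf ?gt_eqF// powRr1// ltW.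
  apply: gt0_ltr_powR; rewrite ?nnegrE ?powR_ge0//.
  near: y; have d0 : 0 < e `^ s^-1 by exact: powR_gt0.
  exists (e `^ s^-1) => //= y; by rewrite /ball/= sub0r normrN.
have xp : 0 < `|x| by rewrite normr_gt0.
apply: (@continuous_comp _ _ _ (fun x : R => `|x|) (fun y => y `^ s)).
  exact: norm_continuous.
apply/differentiable_continuous/derivable1_diffP/derivable_powR.
by rewrite in_itv/= xp.
Unshelve. all: by end_near.
Qed.

Lemma cont_powR (R : realType) (f : R -> R) (s : R) : 0 < s ->
  (forall t, 0 <= f t) -> continuous f -> continuous (fun t => f t `^ s).
Proof.
move=> s0 f0 cf; rewrite (_ : (fun t => _) = (fun x => `|x| `^ s) \o f).
  by move=> t; apply: continuous_comp; [exact: cf|exact: powR_norm_continuous].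
by apply/funext => t /=; rewrite ger0_norm.
Qed.

Lemma cint_cvg (R : realType) (f_ : nat -> R -> R) (f : R -> R) (M : R) :
  (forall n, continuous (f_ n)) -> continuous f ->
  (forall n t, `|f_ n t| <= M) ->
  (forall t, f_ ^~ t @ \oo --> f t) ->
  (fun n => cint (f_ n)) @ \oo --> cint f.
Proof.
move=> cf_ cf fM f_f.
pose mu : {measure set (measurableTypeR R) -> \bar R} := @lebesgue_measure R.
pose D := `[0%R, 2 * pi : R]%classic.
have mD : measurable D by exact: measurable_itv.
pose m g cg := measurable_int mu (@cont_integrable R g cg).
have iM : mu.-integrable D (EFin \o (fun _ : R => M)).
  by apply: cont_integrable => t; exact: cvg_cst.
have [|||iF _ h] := @dominated_convergence _ _ R mu D mD
  (fun n x => (f_ n x)%:E) (fun x => (f x)%:E) (fun=> M%:E)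
  (fun n => m _ (cf_ n)) (m _ cf).
- by apply: aeW => t _ /=; apply: cvg_EFin; [exact: nearW|exact: f_f].
- exact: iM.
- by apply: aeW => t n _ /=; rewrite lee_fin.
rewrite /cint /Rintegral.
by apply: fine_cvg; rewrite fineK//; exact: integrable_fin_num.
Qed.

Lemma cint_powR_cvg (R : realType) (f_ : nat -> R -> R) (f : R -> R) (s M : R) :
  0 < s -> (forall n, continuous (f_ n)) -> continuous f ->
  (forall n t, 0 <= f_ n t <= M) -> (forall t, 0 <= f t) ->
  (forall t, f_ ^~ t @ \oo --> f t) ->
  (fun n => cint (fun t => f_ n t `^ s)) @ \oo --> cint (fun t => f t `^ s).
Proof.
move=> s0 cf_ cf fM f0 f_f.
have f_0 n t : 0 <= f_ n t by have /andP[] := fM n t.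
apply: (@cint_cvg _ _ _ (M `^ s)).
- by move=> n; exact: cont_powR.
- exact: cont_powR.
- move=> n t; rewrite ger0_norm ?powR_ge0//; have /andP[a b] := fM n t.
  by apply: ge0_ler_powR; rewrite ?nnegrE ?(ltW s0)// (le_trans a).
- move=> t; rewrite -[f t]ger0_norm//.
  under eq_fun do rewrite -[f_ _ t]ger0_norm//.
  apply: (@continuous_cvg _ R R \oo _ (f_^~ t) (fun x : R => `|x| `^ s) (f t));
    last exact: f_f.
  exact: powR_norm_continuous.
Qed.

(** * Truncated binomial series *)

(** The generalized binomial coefficient of [sigma] over [m]; [binpoly] is thus the binomial series
    of $(1+z)^\sigma$ cut after degree [N]. *)
Definition bincoef (R : realType) (sigma : R) (m : nat) : R :=
  \prod_(i < m) ((sigma - i%:R) / i.+1%:R).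

Definition binpoly (R : realType) (sigma : R) (N : nat) : {poly R[i]} :=
  \poly_(i < N.+1) (bincoef sigma i)%:C%C.

Lemma bincoef0 (R : realType) (sigma : R) : bincoef sigma 0 = 1.
Proof. by rewrite /bincoef big_ord0. Qed.

Lemma bincoefS (R : realType) (sigma : R) m :
  bincoef sigma m.+1 *+ m.+1 = (sigma - m%:R) * bincoef sigma m.
Proof.
rewrite /bincoef big_ord_recr /= -[LHS]mulr_natr -mulrA divfK ?pnatr_eq0//.
by rewrite mulrC.
Qed.

(** Consecutive coefficients have ratio $|\sigma - i|/(i+1) \le 1$ once $i \ge \sigma$, so the
    moduli do not increase from index [M] on, and the sum of the moduli up to [M] bounds them
    all. *)
Lemma bincoef_bounded (R : realType) (sigma : R) : 0 < sigma ->
  exists2 C : R, 0 < C & forall m, `|bincoef sigma m| <= C.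
Proof.
move=> s0; pose M := (Num.truncn sigma).+1.
have sM : sigma < M%:R by exact: truncnS_gt.
have dec m : `|bincoef sigma (M + m)| <= `|bincoef sigma M|.
  elim: m => [|m ih]; rewrite ?addn0// addnS (le_trans _ ih)//.
  rewrite /bincoef big_ord_recr /= normrM ler_piMr ?normr_ge0// normrM normfV.
  rewrite ler_pdivrMr ?normr_gt0 ?pnatr_eq0// mul1r [leRHS]ger0_norm//.
  have m0 : (0 : R) <= m%:R by [].
  by rewrite -natr1 natrD distrC ger0_norm; lra.
pose C := \sum_(i < M.+1) `|bincoef sigma i|.
have leC i : (i < M.+1)%N -> `|bincoef sigma i| <= C.
  move=> iM; rewrite /C (bigD1 (Ordinal iM))//= lerDl.
  by apply: sumr_ge0 => j _.
exists C => [|m]; first by rewrite (lt_le_trans ltr01)// -(normr1 R) -(bincoef0 sigma) leC.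
have [/leC//|Mm] := ltnP m M.+1.
by rewrite -(subnKC (ltnW Mm)) (le_trans (dec _))// leC.
Qed.

(* The truncation satisfies the differential equation of (1 + z)^sigma up to
   a single term of top degree. *)
Lemma binpoly_ode (R : realType) (sigma : R) N :
  (1 + 'X) * (binpoly sigma N)^`()
  = sigma%:C%C *: binpoly sigma N
    + ((N%:R - sigma) * bincoef sigma N)%:C%C *: 'X^N.
Proof.
apply/polyP => i; rewrite mulrDl mul1r !coefD coefXM !coefZ coefXn !coef_deriv.
rewrite !coef_poly.
have Sm m : (bincoef sigma m.+1)%:C%C *+ m.+1
    = ((sigma - m%:R) * bincoef sigma m)%:C%C :> R[i].
  by rewrite -bincoefS rmorphMn.
have [iN|Ni|->] := ltngtP i N.
- case: i iN => [|i] iN /=; rewrite !ltnS iN ?(ltnW iN) Sm mulr0 !addr0.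
    by rewrite subr0 rmorphM.
  rewrite -rmorphMn -rmorphD -rmorphM -[X in _ + X]mulr_natr; congr (_%:C)%C.
  by ring.
- case: i Ni => [//|i] Ni /=; rewrite !ltnS ltnNge (ltnW Ni) /= ltnNge -ltnS Ni /=.
  by rewrite !mul0rn !mulr0 addr0.
- case: N Sm => [|N] Sm /=.
    by rewrite mul0rn add0r mulr1 sub0r -rmorphM -rmorphD; congr (_%:C)%C; ring.
  rewrite ltnn ltnSn mul0rn add0r mulr1 -rmorphMn -!rmorphM -rmorphD.
  by congr (_%:C)%C; rewrite -[LHS]mulr_natr; ring.
Qed.

Lemma normc_binpoly_le (R : realType) (sigma C x : R) N (z : R[i]) :
  (forall m, `|bincoef sigma m| <= C) -> normc z <= x -> x < 1 ->
  normc (binpoly sigma N).[z] <= C / (1 - x).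
Proof.
move=> cC zx x1; have C0 : 0 <= C by rewrite (le_trans _ (cC 0)).
have x0 : 0 <= x by rewrite (le_trans (normc_ge0 z)).
rewrite horner_poly (le_trans (le_normc_sum _ _ _))//.
apply: (@le_trans _ _ (\sum_(i < N.+1) C * x ^+ i)).
  apply: ler_sum => i _; rewrite normcM normc_real normcX ler_pM//.
    by rewrite exprn_ge0// normc_ge0.
  by rewrite lerXn2r ?nnegrE// normc_ge0.
by rewrite -mulr_sumr ler_wpM2l// sum_geometric_le.
Qed.

Lemma cvg0Ml (R : realType) (a : R) (u : nat -> R) :
  u @ \oo --> (0 : R) -> (fun n => a * u n) @ \oo --> (0 : R).
Proof.
move=> u0; have := @cvgM _ _ \oo _ (fun=> a) u a 0 (@cvg_cst _ _ _ _ _) u0.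
by rewrite mulr0; apply.
Qed.

(** Split $x^N = y^N y^N$ with $y = \sqrt x$: the product $(N+1)y^N$ is at most a geometric sum,
    hence bounded, and the other $y^N$ tends to 0. *)
Lemma cvg_natr_geometric (R : realType) (x : R) : 0 <= x -> x < 1 ->
  (fun N => N.+1%:R * x ^+ N) @ \oo --> (0 : R).
Proof.
move=> x0 x1; pose y := Num.sqrt x.
have y0 : 0 <= y by exact: sqrtr_ge0.
have y1 : y < 1 by rewrite -sqrtr1 ltr_sqrt.
have h N : N.+1%:R * y ^+ N <= (1 - y)^-1.
  apply: (le_trans _ (sum_geometric_le N.+1 y0 y1)).
  rewrite mulr_natl -[X in _ *+ X]card_ord -sumr_const ler_sum// => i _.
  by apply: ler_wiXn2l; rewrite ?(ltW y1) ?leq_ord.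
apply: (@squeeze_cvgr _ _ _ _ (fun=> 0) (fun N => (1 - y)^-1 * y ^+ N)).
- apply: nearW => N; rewrite mulr_ge0 ?exprn_ge0//=.
  rewrite -[x]sqr_sqrtr// -/y -exprM mul2n -addnn exprD mulrA.
  by rewrite ler_wpM2r ?exprn_ge0.
- exact: cvg_cst.
- by apply: cvg0Ml; apply: cvg_expr; rewrite ger0_norm.
Qed.

Lemma sqr_normcC (R : rcfType) (z : R[i]) : (normc z ^+ 2)%:C%C = z * z^*%C.
Proof.
rewrite sqr_normcE; case: z => a b /=; apply/eqP; rewrite eq_complex /=.
by apply/andP; split; apply/eqP; ring.
Qed.

Lemma cRe_realM (R : rcfType) (a : R) (z : R[i]) : Re (a%:C%C * z) = a * Re z.
Proof. by rewrite cReM /= mul0r subr0. Qed.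

Lemma is_derive_sqr_normc (R : realType) (f : R -> R[i]) (t : R) d :
  cderiv f t d ->
  is_derive t 1 (fun t => normc (f t) ^+ 2) (2 * Re ((f t)^*%C * d)).
Proof.
move=> [f1 f2].
rewrite (_ : (fun t => _)
    = (fun t => Re (f t) * Re (f t) + Im (f t) * Im (f t))); last first.
  by apply/funext => u; rewrite sqr_normcE !expr2.
apply: (is_derive_eq (is_deriveD (is_derive_mul f1 f1) (is_derive_mul f2 f2))).
by rewrite cReM; case: (f t) => a b /=; ring.
Qed.

Lemma gt0_powRD (R : realType) (x r s : R) : 0 < x ->
  x `^ (r + s) = x `^ r * x `^ s.
Proof. by move=> x0; rewrite powRD// (gt_eqF x0) implybT. Qed.

(* Along the ray [t z] the differential equation makes
   [|G (t z)|^2 |1 + t z|^(-2 sigma)] almost constant. *)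
Lemma binpoly_ray (R : realType) (sigma C x : R) N (z : R[i]) : 0 < sigma ->
  (forall m, `|bincoef sigma m| <= C) -> normc z = x -> x < 1 ->
  `|normc (binpoly sigma N).[z] ^+ 2 * (normc (1 + z) ^+ 2) `^ (- sigma) - 1|
  <= 4 * ((1 - x) ^+ 2) `^ (- sigma - 1) * (C / (1 - x)) * C * (N.+1%:R * x ^+ N).
Proof.
move=> s0 cC zx x1; have C0 : 0 <= C by rewrite (le_trans _ (cC 0)).
have x0 : 0 <= x by rewrite -zx normc_ge0.
set G := binpoly sigma N.
(* Along the segment from 0 to [z]: the truncated series, the base $1 + tz$, and the top-degree
   remainder of the differential equation. *)
pose y (t : R) := G.[t%:C%C * z]; pose w (t : R) := 1 + t%:C%C * z.
pose e (t : R) := ((N%:R - sigma) * bincoef sigma N)%:C%C * (t%:C%C * z) ^+ N.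
have dy t : cderiv y t (G^`().[t%:C%C * z] * z).
  exact/cderiv_horner/cderiv_line.
have dw t : cderiv w t z.
  apply: (cderiv_eq (cderivD (cderiv_cst 1 t) (cderiv_line z t))).
  by rewrite add0r.
have ode t : w t * (G^`().[t%:C%C * z] * z) = z * (sigma%:C%C * y t + e t).
  have := congr1 (fun p => p.[t%:C%C * z]) (binpoly_ode sigma N).
  rewrite hornerM !hornerD !hornerZ hornerXn hornerX hornerC -/G /w /y /e => <-.
  by ring.
have tz t : t \in `[0, 1]%R -> normc (t%:C%C * z) <= x.
  rewrite in_itv /= => /andP[t0 t1].
  by rewrite normcM normc_real ger0_norm// zx ler_piMl.
have w1 t : t \in `[0, 1]%R -> 1 - x <= normc (w t).
  move=> /tz h; rewrite /w -[_ * z]opprK.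
  by rewrite (le_trans _ (le_normc_sub _ _))// normc1 normcN lerD2l lerN2.
have w0 t : t \in `[0, 1]%R -> 0 < normc (w t) ^+ 2.
  by move=> /w1 h; rewrite exprn_gt0// (lt_le_trans _ h)// subr_gt0.
pose v t := normc (y t) ^+ 2 * (normc (w t) ^+ 2) `^ (- sigma).
pose dv t := 2 * (normc (w t) ^+ 2) `^ (- sigma - 1)
  * Re ((w t)^*%C * (y t)^*%C * z * e t).
have vd (t : R) : t \in `[0, 1]%R -> is_derive t 1 v (dv t).
  move=> t01; have D0 := w0 _ t01.
  have h1 := is_derive_sqr_normc (dy t).
  have h2 := @is_derive1_comp R (@powR R ^~ (- sigma))
    (fun t => normc (w t) ^+ 2) t _ _ (is_derive1_powR (- sigma) D0)
    (is_derive_sqr_normc (dw t)).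
  apply: (is_derive_eq (is_derive_mul h1 h2)).
  rewrite /dv /comp; set D := normc (w t) ^+ 2.
  have -> : D `^ (- sigma) = D * D `^ (- sigma - 1).
    rewrite -[X in _ = X * _]powRr1 ?(ltW D0)// -gt0_powRD//.
    by congr (_ `^ _); ring.
  (* The differential equation is multiplied by $\bar w \bar y$; the terms in [sigma] then cancel in
     the derivative of [v], and only the remainder [e] survives. *)
  have key : D * Re ((y t)^*%C * (G^`().[t%:C%C * z] * z))
      = sigma * (normc (y t) ^+ 2 * Re ((w t)^*%C * z))
        + Re ((w t)^*%C * (y t)^*%C * z * e t).
    rewrite -!cRe_realM -cReD !sqr_normcC; congr (Re _).
    transitivity ((w t)^*%C * (y t)^*%C * (w t * (G^`().[t%:C%C * z] * z))).
      by ring.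
    by rewrite ode; ring.
  set a := Re _ in key *; set b := Re _ in key *; set c := Re _ in key *.
  set n := normc _ ^+ 2 in key *; set E := D `^ _.
  transitivity (2 * E * (D * a - sigma * (n * b))); first by ring.
  by rewrite key; ring.
have cv : {within `[0, 1], continuous v}.
  apply: derivable_within_continuous => t /vd h; exact: ex_derive.
have vd' (t : R) : t \in `]0, 1[%R -> is_derive t 1 v (dv t).
  by move=> /subset_itv_oo_cc; exact: vd.
(* As $v(0) = 1$, the quantity to bound is $v(1) - v(0)$, a value of [dv] by the mean value
   theorem. *)
have [c c01 vE] := MVT_segment ler01 vd' cv.
have v1 : v 1 = normc G.[z] ^+ 2 * (normc (1 + z) ^+ 2) `^ (- sigma).
  by rewrite /v /y /w rmorph1 mul1r.
have v0 : v 0 = 1.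
  rewrite /v /y /w rmorph0 mul0r addr0 normc1 expr1n powR1 mulr1.
  by rewrite horner_coef0 coef_poly ltn0Sn bincoef0 rmorph1 normc1 expr1n.
move: vE; rewrite v0 subr0 mulr1 -v1 => ->; rewrite /dv.
have wc := w1 _ c01; have tzc := tz _ c01.
have yc : normc (y c) <= C / (1 - x) by exact: normc_binpoly_le.
have wc2 : normc (w c) <= 2.
  by rewrite (le_trans (le_normcD _ _))// normc1; lra.
have ec : normc (e c) <= C * (N.+1%:R * x ^+ N).
  rewrite normcM normcX normc_real mulrA ler_pM ?exprn_ge0 ?normc_ge0//; last first.
    by rewrite lerXn2r ?nnegrE ?normc_ge0.
  rewrite -opprB mulNr normrN -bincoefS normrMn -[leLHS]mulr_natr.
  by rewrite ler_wpM2r.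
(* The exponent is negative, so the lower bound $1 - x$ on $|w|$ becomes an upper bound. *)
have Dc : (normc (w c) ^+ 2) `^ (- sigma - 1) <= ((1 - x) ^+ 2) `^ (- sigma - 1).
  have -> : - sigma - 1 = - (sigma + 1) by ring.
  have x1' : 0 < (1 - x) ^+ 2 by rewrite exprn_gt0// subr_gt0.
  rewrite !powRN lef_pV2 ?posrE ?powR_gt0 ?w0//.
  apply: ge0_ler_powR; rewrite ?nnegrE ?sqr_ge0//; first by lra.
  by rewrite lerXn2r ?nnegrE ?normc_ge0// subr_ge0 ltW.
rewrite !normrM (@ger0_norm _ 2)// [X in _ * X * _]ger0_norm ?powR_ge0//.
set L := ((1 - x) ^+ 2) `^ _; set K := C / (1 - x).
have L0 : 0 <= L by exact: powR_ge0.
(* The 4 is the 2 of [dv] times the bound 2 on $|w|$; the factor 1 bounds $|z|$. *)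
rewrite (_ : 4 * L * K * C * (N.+1%:R * x ^+ N)
  = (2 * L) * (2 * K * 1 * (C * (N.+1%:R * x ^+ N)))); last by ring.
apply: ler_pM; rewrite ?mulr_ge0 ?powR_ge0//; first by rewrite ler_wpM2l.
apply: (le_trans (normr_Re_le _)); move: (e c) ec => d ec; rewrite !normcM !normc_conj zx.
rewrite ler_pM ?mulr_ge0 ?normc_ge0//.
by rewrite ler_pM ?mulr_ge0 ?normc_ge0 ?(ltW x1)// ler_pM ?normc_ge0.
Qed.

(** By the estimate along the ray, $|G_N(z)|^2 |1+z|^{-2\sigma}$ differs from 1 by at most a
    multiple of $(N+1)|z|^N$. *)
Lemma sqr_normc_binpoly_cvg (R : realType) (sigma : R) (z : R[i]) :
  0 < sigma -> normc z < 1 ->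
  (fun N => normc (binpoly sigma N).[z] ^+ 2) @ \oo -->
    normc (1 + z) `^ (2 * sigma).
Proof.
move=> s0 z1; have [C C0 cC] := bincoef_bounded s0.
set D := normc (1 + z) ^+ 2.
have D0 : 0 < D.
  rewrite exprn_gt0// -[z]opprK (lt_le_trans _ (le_normc_sub _ _))//.
  by rewrite normc1 normcN subr_gt0.
have -> : normc (1 + z) `^ (2 * sigma) = 1 * D `^ sigma.
  by rewrite mul1r powRrM powR_mulrn// normc_ge0.
have h : (fun N => normc (binpoly sigma N).[z] ^+ 2 * D `^ (- sigma)) @ \oo --> (1 : R).
  apply/subr_cvg0; apply/norm_cvg0P.
  set x := normc z in z1.
  pose K := 4 * ((1 - x) ^+ 2) `^ (- sigma - 1) * (C / (1 - x)) * C.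
  apply: (@squeeze_cvgr _ _ _ _ (fun=> 0) (fun N => K * (N.+1%:R * x ^+ N))).
  - by apply: nearW => N; rewrite normr_ge0/= binpoly_ray.
  - exact: cvg_cst.
  - by apply: cvg0Ml; apply: cvg_natr_geometric => //; exact: normc_ge0.
rewrite (_ : (fun N => _) = (fun N =>
    (normc (binpoly sigma N).[z] ^+ 2 * D `^ (- sigma)) * D `^ sigma)).
  exact: cvgMl.
apply/funext => N; rewrite -mulrA -gt0_powRD//.
by rewrite addNr powRr0 mulr1.
Qed.

(** * Subordination *)

(** With $\sigma = s/2$, the squares $|G_N|^2$ tend boundedly to $|1+z|^s$ on $|z| \le \tau$, so the
    comparison [cint_sqr_comp_le] passes to the limit. *)
Lemma cint_powR_subordinate (R : realType) (W : {poly R[i]}) (tau s : R) :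
  W`_0 = 0 -> 0 <= tau -> tau < 1 -> 0 < s ->
  (forall t, normc W.[expi t] <= tau) ->
  cint (fun t => normc (1 + W.[expi t]) `^ s)
  <= cint (fun t => normc (1 + tau%:C%C * expi t) `^ s).
Proof.
move=> W0 t0 t1 s0 Wt; have s20 : 0 < s / 2 by rewrite divr_gt0.
have [C C0 cC] := bincoef_bounded s20.
have lim (f : R -> R[i]) : ccont f -> (forall t, normc (f t) <= tau) ->
    (fun N => cint (fun t => normc (binpoly (s / 2) N).[f t] ^+ 2)) @ \oo -->
    cint (fun t => normc (1 + f t) `^ s).
  move=> cf ft; apply: (@cint_cvg _ _ _ ((C / (1 - tau)) ^+ 2)).
  - by move=> n; exact: cont_sqr_normc_horner.
  - apply: cont_powR => // [t|]; first exact: normc_ge0.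
    by apply: cont_normc; apply: ccontD => //; exact: ccont_cst.
  - move=> n t; rewrite ger0_norm ?sqr_ge0// lerXn2r ?nnegrE ?normc_ge0//.
      by rewrite divr_ge0 ?(ltW C0)// subr_ge0 ltW.
    exact: normc_binpoly_le.
  - move=> t; have := sqr_normc_binpoly_cvg s20 (le_lt_trans (ft t) t1).
    by have -> : 2 * (s / 2) = s by field.
have ce := ccont_expi R.
have c1 : ccont (fun t => tau%:C%C * expi t) by apply: ccontM => //; exact: ccont_cst.
apply: (ler_cvg_to (lim _ (ccont_horner W ce) Wt) (lim _ c1 _)).
  by move=> t; rewrite normcM normc_expi mulr1 normc_real ger0_norm.
by apply: nearW => N; exact: cint_sqr_comp_le.
Qed.

Lemma cvg_natr_inv (R : realType) (c : R) :
  (fun n : nat => c / n.+1%:R) @ \oo --> (0 : R).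
Proof. by apply: cvg0Ml; exact: cvg_harmonic. Qed.

Lemma normc_cvg (R : realType) (u : nat -> R[i]) (l : R[i]) (e : nat -> R) :
  e @ \oo --> (0 : R) -> (forall n, normc (u n - l) <= e n) ->
  (fun n => normc (u n)) @ \oo --> normc l.
Proof.
move=> e0 ue; apply/subr_cvg0/norm_cvg0P.
apply: (@squeeze_cvgr _ _ _ _ (fun=> 0) e) => //; last exact: cvg_cst.
apply: nearW => n; rewrite normr_ge0/= (le_trans (ler_dist_normc _ _))//.
Qed.

(** $A/B$ is a uniform limit of polynomials $A C_n$ vanishing at 0, to which the polynomial case
    applies with radii tending to [tau]. *)
Lemma cint_powR_subordinate_rational (R : realType) (A B : {poly R[i]})
    (tau s : R) :
  (forall z, normc z <= 1 -> B.[z] != 0) -> A`_0 = 0 ->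
  0 <= tau -> tau < 1 -> 0 < s ->
  (forall z, normc z = 1 -> normc A.[z] <= tau * normc B.[z]) ->
  cint (fun t => (normc (B + A).[expi t] / normc B.[expi t]) `^ s)
  <= cint (fun t => normc (1 + tau%:C%C * expi t) `^ s).
Proof.
move=> Bn0 A0 t0 t1 s0 AB.
have ce := ccont_expi R; have ne := @normc_expi R.
have Be t : B.[expi t] != 0 by rewrite Bn0// ne.
(* A tolerance of at most $1 - \tau$ keeps the enlarged radius $\tau(1 + e_n)$ below $1 - (1-\tau)^2
   < 1$. *)
pose e (n : nat) : R := (1 - tau) / n.+1%:R.
have e0 n : 0 < e n by rewrite divr_gt0// subr_gt0.
have e1 n : e n <= 1 - tau.
  by rewrite ler_pdivrMr// ler_peMr ?subr_ge0 ?(ltW t1)// ler1n.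
have ecvg : e @ \oo --> (0 : R) by exact: cvg_natr_inv.
have [C hC] := @choice _ _ (fun n (C : {poly R[i]}) => forall z, normc z <= 1 ->
  normc (1 - C.[z] * B.[z]) <= e n) (fun n => poly_inverse_approx Bn0 (e0 n)).
pose T n := tau * (1 + e n).
have T0 n : 0 <= T n by rewrite mulr_ge0// addr_ge0// ltW.
have T1 n : T n < 1.
  apply: (@le_lt_trans _ _ (tau * (1 + (1 - tau)))).
    by rewrite ler_wpM2l// lerD2l.
  by have : 0 < (1 - tau) ^+ 2 by [rewrite exprn_gt0// subr_gt0]; nra.
have W n t : normc (A * C n).[expi t] <= T n.
  have -> : (A * C n).[expi t] = A.[expi t] * (C n).[expi t] by rewrite hornerM.
  rewrite normcM.
  apply: (@le_trans _ _ (tau * normc B.[expi t] * normc (C n).[expi t])).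
    by rewrite ler_wpM2r ?normc_ge0// AB.
  rewrite -mulrA ler_wpM2l// mulrC -normcM.
  have := hC n (expi t); rewrite ne lexx => /(_ isT) h.
  rewrite -(subKr 1 (_ * _)) (le_trans (le_normcB _ _))// normc1.
  by rewrite lerD2l.
have lim1 : (fun n => cint (fun t => normc (1 + (A * C n).[expi t]) `^ s)) @ \oo -->
    cint (fun t => (normc (B + A).[expi t] / normc B.[expi t]) `^ s).
  apply: (@cint_powR_cvg _ _ _ _ 2) => //.
  - move=> n; apply: cont_normc; apply: ccontD; first exact: ccont_cst.
    exact: ccont_horner.
  - apply: cont_mul; first exact/cont_normc/ccont_horner.
    move=> t; apply: cvgV; first by rewrite normc_eq0.
    exact: (cont_normc (ccont_horner B ce)).
  - move=> n t; rewrite normc_ge0 andTb (le_trans (le_normcD _ _))// normc1.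
    by have := W n t; have := T1 n; lra.
  - by move=> t; rewrite divr_ge0// normc_ge0.
  - move=> t; rewrite -normcV -normcM.
    apply: (@normc_cvg _ _ _ e ecvg) => n.
    (* Up to sign the error is $A/B$ times $1 - CB$, and $|A/B| \le \tau < 1$ on the circle. *)
    rewrite (_ : 1 + _ - _ = - (A.[expi t] / B.[expi t])
        * (1 - (C n).[expi t] * B.[expi t])); last first.
      by rewrite hornerM hornerD; field; exact: Be.
    rewrite normcM normcN -[leRHS]mul1r ler_pM ?normc_ge0//; last first.
      by rewrite hC// ne.
    rewrite normcM normcV ler_pdivrMr ?normc_gt0// mul1r.
    apply: (le_trans (AB _ (ne t))).
    by rewrite ler_piMl ?normc_ge0// ltW.
have cl (a : R) : ccont (fun t => 1 + a%:C%C * expi t).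
  by apply: ccontD; [|apply: ccontM => //]; exact: ccont_cst.
have lim2 : (fun n => cint (fun t => normc (1 + (T n)%:C%C * expi t) `^ s)) @ \oo -->
    cint (fun t => normc (1 + tau%:C%C * expi t) `^ s).
  apply: (@cint_powR_cvg _ _ _ _ 2) => //.
  - by move=> n; exact: cont_normc.
  - exact: cont_normc.
  - move=> n t; rewrite normc_ge0 andTb (le_trans (le_normcD _ _))// normc1.
    by rewrite normcM ne normc_real ger0_norm//; have := T1 n; lra.
  - by move=> t; exact: normc_ge0.
  - move=> t; apply: (@normc_cvg _ _ _ e ecvg) => n.
    rewrite (_ : _ - _ = (T n - tau)%:C%C * expi t); last by rewrite rmorphB; ring.
    rewrite normcM ne mulr1 normc_real /T mulrDr mulr1 addrAC subrr add0r.
    have en := ltW (e0 n); rewrite (ger0_norm (mulr_ge0 t0 en)).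
    by apply: ler_piMl => //; exact: ltW.
apply: (ler_cvg_to lim1 lim2); apply: nearW => n.
by apply: cint_powR_subordinate => //; rewrite coef0M A0 mul0r.
Qed.

(** * The reciprocal polynomial *)

(** This is $z^n \overline{p(1/\bar z)}$. The degree [n] is a parameter because polynomials of lower
    degree, such as $nP - zP'$, are also reversed with respect to [n]. *)
Definition revpoly (R : rcfType) (n : nat) (p : {poly R[i]}) : {poly R[i]} :=
  \poly_(i < n.+1) (p`_(n - i))^*%C.

Lemma horner_revpoly (R : rcfType) n (p : {poly R[i]}) (z : R[i]) :
  (size p <= n.+1)%N -> z * z^*%C = 1 ->
  (revpoly n p).[z] = z ^+ n * (p.[z])^*%C.
Proof.
move=> pn z1; rewrite horner_poly (horner_coef_wide _ pn) rmorph_sum mulr_sumr.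
rewrite (reindex_inj rev_ord_inj)/=; apply: eq_bigr => i _.
rewrite subSS subKn -1?ltnS// rmorphM rmorphXn mulrCA; congr (_ * _).
have -> : z ^+ n = z ^+ (n - i) * z ^+ i by rewrite -exprD subnK ?leq_ord.
by rewrite -mulrA -exprMn [z * _]z1 expr1n mulr1.
Qed.

(** Coefficient $i$ is multiplied by $i = n - (n-i)$, and $n - i$ is the exponent before
    reversal. *)
Lemma mulX_deriv_revpoly (R : rcfType) n (p : {poly R[i]}) :
  (size p <= n.+1)%N ->
  'X * (revpoly n p)^`() = revpoly n (p *+ n - 'X * p^`()).
Proof.
move=> pn; apply/polyP => i; rewrite coefXM coef_deriv !coef_poly.
have [->|i0] := eqVneq i 0%N.
  rewrite subn0 ltn0Sn coefB coefMn coefXM coef_deriv; case: n pn => [|n] pn.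
    by rewrite eqxx mulr0n subrr rmorph0.
  by rewrite /= subrr rmorph0.
rewrite prednK ?lt0n//; case: ltnP => [|_]; last by rewrite mul0rn.
rewrite ltnS => le_in; rewrite coefB coefMn coefXM coef_deriv.
have [ni|ni] := eqVneq (n - i)%N 0%N.
  have -> : i = n by apply/eqP; rewrite eqn_leq le_in -subn_eq0 ni.
  by rewrite subnn subr0 rmorphMn.
rewrite prednK ?lt0n// -mulrnBr ?leq_subr// subKn//.
by rewrite rmorphMn.
Qed.

Lemma revpoly_mulXsubC (R : rcfType) n (b : R[i]) (p : {poly R[i]}) :
  (size p <= n.+1)%N ->
  revpoly n.+1 (('X - b%:P) * p) = (1 - (b^*%C)%:P * 'X) * revpoly n p.
Proof.
move=> pn; apply/polyP => i.
rewrite [in RHS]mulrBl mul1r -mulrA coefB coefCM coefXM !coef_poly mulrBl.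
rewrite coefB coefXM coefCM rmorphB rmorphM.
case: i => [|i] /=.
  by rewrite mulr0 !subn0 [p`_n.+1]nth_default// conjc0 mulr0.
rewrite !ltnS subSS; have [lin|lni|->] := ltngtP i n.
- rewrite subn_eq0 leqNgt lin /=.
  by rewrite -subnS.
- by rewrite mulr0 subr0.
- by rewrite subnn eqxx rmorph0.
Qed.

Lemma revpoly_prod (R : rcfType) (s : seq R[i]) :
  revpoly (size s) (\prod_(b <- s) ('X - b%:P))
  = \prod_(b <- s) (1 - (b^*%C)%:P * 'X).
Proof.
elim: s => [|b s ih].
  rewrite !big_nil; apply/polyP => i.
  by rewrite coef_poly !coef1; case: i => [|i] //=; exact: conjc1.
by rewrite !big_cons /= revpoly_mulXsubC ?ih// size_prod_XsubC.
Qed.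

Lemma revpolyZ (R : rcfType) n (c : R[i]) (p : {poly R[i]}) :
  revpoly n (c *: p) = c^*%C *: revpoly n p.
Proof.
apply/polyP => i; rewrite coefZ !coef_poly; case: ifP; last by rewrite mulr0.
by rewrite coefZ rmorphM.
Qed.

(** With $a = \Re z$, the real part is $(1-a)/|1-z|^2$, and $|1-z|^2 = 1 - 2a + |z|^2 < 2(1-a)$. *)
Lemma Re_inv_subr_ge (R : rcfType) (z : R[i]) : normc z < 1 ->
  1 / 2 <= Re (1 - z)^-1.
Proof.
move=> z1; have z2 : Re z ^+ 2 + Im z ^+ 2 < 1.
  by rewrite -sqr_normcE expr_lt1// normc_ge0.
have : 0 < normc (1 - z) ^+ 2.
  rewrite exprn_gt0// (lt_le_trans _ (le_normc_sub _ _))//.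
  by rewrite normc1 subr_gt0.
rewrite sqr_normcE; case: z {z1} z2 => a b /= h d0.
rewrite ler_pdivlMr//; move: d0 h; rewrite !expr2 => d0 h.
by nra.
Qed.

(* [(n q - z q') / q] is the sum of the [1 / (1 - b^* z)]. *)
Lemma Re_logderiv_ge (R : rcfType) (s : seq R[i]) (z : R[i]) :
  (forall b, b \in s -> normc (b * z) < 1) ->
  let q := \prod_(b <- s) (1 - (b^*%C)%:P * 'X) in
  q.[z] != 0 /\
  (size s)%:R / 2 <= Re (((size s)%:R * q.[z] - z * q^`().[z]) / q.[z]).
Proof.
elim: s => [|b s ih] hs /=.
  rewrite big_nil hornerC oner_eq0 derivC horner0 mulr0 subr0.
  by rewrite mul0r mul0r mul0r.
have [|q0 hq] := ih; first by move=> c cs; rewrite hs// inE cs orbT.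
have bz : normc (b^*%C * z) < 1.
  by rewrite normcM normc_conj -normcM hs// mem_head.
rewrite big_cons; set q := \prod_(j <- s) _ in q0 hq *.
have d0 : 1 - b^*%C * z != 0.
  rewrite -normc_gt0 (lt_le_trans _ (le_normc_sub _ _))//.
  by rewrite normc1 subr_gt0.
have fz : (1 - (b^*%C)%:P * 'X).[z] = 1 - b^*%C * z by rewrite !hornerE.
have f'z : ((1 - (b^*%C)%:P * 'X)^`() = - (b^*%C)%:P)%R.
  by rewrite derivB -polyC1 !derivC mul_polyC derivZ derivX sub0r alg_polyC.
split; first by rewrite hornerM fz mulf_neq0.
rewrite derivM f'z !hornerD !hornerM hornerN hornerC fz.
rewrite (_ : _ / _ = (1 - b^*%C * z)^-1
  + ((size s)%:R * q.[z] - z * q^`().[z]) / q.[z]); last first.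
  by rewrite -natr1; field; rewrite d0 q0.
rewrite cReD -[in leLHS]natr1 mulrDl addrC lerD//.
exact: Re_inv_subr_ge.
Qed.

(** For $L = (nQ - zQ')/Q$ one has $zQ'/Q = n - L$. The bound $\Re L \ge n/2 > 0$ makes $L$ nonzero
    and no closer to 0 than to $n$. *)
Lemma reciprocal_dominates (R : realType) n (P : {poly R[i]}) (z : R[i]) :
  size P = n.+1 -> (0 < n)%N ->
  (forall b, root P b -> normc (b * z) < 1) ->
  let Q := revpoly n P in
  (Q *+ n - 'X * Q^`()).[z] != 0 /\
  normc ('X * Q^`()).[z] <= normc (Q *+ n - 'X * Q^`()).[z].
Proof.
move=> sP n0 Pz; have [s Ps] := closed_field_poly_normal P.
have lP : lead_coef P != 0 by rewrite lead_coef_eq0 -size_poly_gt0 sP.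
have ss : size s = n.
  by apply/eqP; rewrite -eqSS -sP Ps size_scale// size_prod_XsubC.
have [|] := @Re_logderiv_ge _ s z.
  by move=> b bs; apply: Pz; rewrite Ps rootZ// root_prod_XsubC.
set q := \prod_(b <- s) _ => q0 hq Q.
have QE : Q = (lead_coef P)^*%C *: q by rewrite /Q Ps revpolyZ -ss revpoly_prod -Ps.
have Q0 : Q.[z] != 0 by rewrite QE hornerZ mulf_neq0// conjc_eq0.
rewrite ss in hq; set L := _ / q.[z] in hq.
have LE : (Q *+ n - 'X * Q^`()).[z] = L * Q.[z].
  rewrite hornerD hornerN hornerMn hornerM hornerX QE derivZ !hornerZ /L.
  by rewrite -mulr_natl; field.
have AE : ('X * Q^`()).[z] = (n%:R - L) * Q.[z].
  by rewrite mulrBl -LE hornerD hornerN hornerMn mulr_natl; ring.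
clearbody L.
have n0' : 0 < n%:R :> R by rewrite ltr0n.
split.
  rewrite LE mulf_neq0//; apply: contraTneq hq => ->.
  by rewrite -ltNge divr_gt0.
rewrite AE LE !normcM ler_wpM2r ?normc_ge0//.
rewrite -ler_sqr ?nnegrE ?normc_ge0// !sqr_normcE.
have nE : n%:R = (n%:R : R)%:C%C by rewrite rmorph_nat.
rewrite nE; case: L hq {LE AE} => a b /= hq; rewrite sub0r !expr2.
by nra.
Qed.

(** * Schwarz' lemma for the reciprocal polynomial, up to the unit circle *)

Lemma cvgX_seq (R : realType) (u : nat -> R) (l : R) m :
  u @ \oo --> l -> (fun n => u n ^+ m) @ \oo --> l ^+ m.
Proof.
move=> ul; elim: m => [|m ih]; first by under eq_fun do rewrite expr0; exact: cvg_cst.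
by under eq_fun do rewrite exprS; rewrite exprS; exact: cvgM.
Qed.

Lemma cvg_interpolate (R : realType) (y c : R) :
  (fun n : nat => y + c / n.+2%:R) @ \oo --> y.
Proof.
have h : (fun n : nat => c / n.+2%:R) @ \oo --> (0 : R).
  by have := cvg_natr_inv c; rewrite -(cvg_shiftS (fun n : nat => c / n.+1%:R)).
have := @cvgD _ _ _ \oo _ (fun=> y) _ y 0 (@cvg_cst _ _ _ _ _) h.
by rewrite addr0; apply.
Qed.

(* Schwarz' lemma on the disk of radius [1 / k]: [A] vanishes to order [mu]
   at the origin. *)
Lemma reciprocal_schwarz (R : realType) n mu (P : {poly R[i]}) (k : R) :
  size P = n.+1 -> (0 < mu <= n)%N -> 0 <= k ->
  (forall b, root P b -> normc b <= k) ->
  (forall i, (n - mu < i < n)%N -> P`_i = 0) ->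
  let Q := revpoly n P in forall z, k * normc z < 1 ->
  normc ('X * Q^`()).[z]
  <= (k * normc z) ^+ mu * normc (Q *+ n - 'X * Q^`()).[z].
Proof.
move=> sP /andP[mu0 mun] k0 Pk Pmu Q z kz.
have n0 : (0 < n)%N by exact: leq_trans mun.
set A := 'X * Q^`(); set B := Q *+ n - A.
have AB u : k * normc u < 1 -> B.[u] != 0 /\ normc A.[u] <= normc B.[u].
  move=> ku; apply: reciprocal_dominates => // b /Pk bk.
  by rewrite normcM (le_lt_trans _ ku)// ler_wpM2r ?normc_ge0.
pose A1 : {poly R[i]} := \poly_(i < size A) A`_(i + mu).
have A1E : A = A1 * 'X^mu.
  apply/polyP => i; rewrite coefMXn; case: ltnP => im.
    rewrite /A coefXM; case: eqVneq => // i0.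
    rewrite coef_deriv prednK ?lt0n// coef_poly; case: ifP; rewrite ?mul0rn// ltnS => le_in.
    (* For $0 < i < \mu$, coefficient $i$ of $Q$ is the conjugate of that of $P$ at $n - i$, inside
       the gap. *)
    rewrite Pmu ?rmorph0 ?mul0rn//.
    by lia.
  rewrite coef_poly subnK//; case: ltnP => // h.
  by rewrite nth_default// (leq_trans h)// leq_subr.
have [->|z0] := eqVneq z 0.
  rewrite hornerM hornerX mul0r normc0.
  by rewrite mulr_ge0 ?normc_ge0// exprn_ge0// mulr_ge0.
have nz : 0 < normc z by rewrite normc_gt0.
have main x : k * normc z < x -> x < 1 -> normc A.[z] <= x ^+ mu * normc B.[z].
  move=> kx x1; have x0 : 0 < x by rewrite (le_lt_trans _ kx)// mulr_ge0// ltW.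
  (* On the circle of radius $r$, which encloses [z] and satisfies $kr < 1$, one has $r^\mu |A_1| =
     |A| \le |B|$. The maximum principle carries $|A_1| \le r^{-\mu}|B|$ to [z], and $|z|/r = x$. *)
  pose r := normc z / x; have r0 : 0 < r by rewrite divr_gt0.
  have kr : k * r < 1 by rewrite mulrA ltr_pdivrMr// mul1r.
  pose S : {poly R[i]} := r%:C%C *: 'X.
  have SE u : S.[u] = r%:C%C * u by rewrite hornerZ hornerX.
  have nS u : normc S.[u] = r * normc u by rewrite SE normcM normc_real gtr0_norm.
  have kS u : normc u <= 1 -> k * normc S.[u] < 1.
    move=> u1; rewrite nS mulrA (le_lt_trans _ kr)// ler_piMr//.
    by rewrite mulr_ge0// ltW.
  have h : normc (A1 \Po S).[z / r%:C%C] <= (r ^+ mu)^-1 * normc (B \Po S).[z / r%:C%C].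
    apply: rational_max_principle.
    - by move=> u u1; rewrite horner_comp; have [] := AB _ (kS _ u1).
    - by rewrite invr_ge0 exprn_ge0// ltW.
    - move=> u u1; have [|_] := AB S.[u]; first by rewrite kS// u1.
      rewrite A1E hornerM hornerXn normcM normcX nS u1 mulr1 !horner_comp => h.
      by rewrite mulrC ler_pdivlMr ?exprn_gt0.
    - rewrite normcM normcV normc_real gtr0_norm// ler_pdivrMr// mul1r.
      by rewrite ler_pdivlMr// ler_piMr// ltW.
  have SK : S.[z / r%:C%C] = z.
    by rewrite SE mulrC divfK// -normc_eq0 normc_real gtr0_norm// gt_eqF.
  rewrite !horner_comp SK in h.
  rewrite A1E hornerM hornerXn normcM normcX mulrC.
  have -> : x ^+ mu = normc z ^+ mu / r ^+ mu.
    by rewrite -expr_div_n; congr (_ ^+ _); rewrite /r; field; rewrite !gt_eqF.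
  by rewrite -mulrA ler_wpM2l// exprn_ge0// ltW.
set y := k * normc z in kz main *.
(* These values tend to [y]; the denominator $j + 2$ keeps them strictly between [y] and 1. *)
pose x (j : nat) := y + (1 - y) / j.+2%:R.
have xy : (fun j => x j ^+ mu * normc B.[z]) @ \oo --> y ^+ mu * normc B.[z].
  apply: cvgM; last exact: cvg_cst.
  exact/cvgX_seq/cvg_interpolate.
have cA : (fun _ : nat => normc A.[z]) @ \oo --> normc A.[z] by exact: cvg_cst.
apply: (ler_cvg_to cA xy); apply: nearW => j.
have y1 : 0 < 1 - y by rewrite subr_gt0.
apply: main; first by rewrite ltrDl divr_gt0.
by rewrite -ltrBrDl ltr_pdivrMr// ltr_pMr// ltr1n.
Qed.

(** For $k = 1$ the unit circle is outside the region $k|z| < 1$, so it is approached from inside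
    along the radii $1 - 1/(j+2)$. *)
Lemma reciprocal_circle_le (R : realType) n mu (P : {poly R[i]}) (k : R) (z : R[i]) :
  size P = n.+1 -> (0 < mu <= n)%N -> 0 <= k -> k <= 1 ->
  (forall b, root P b -> normc b <= k) ->
  (forall i, (n - mu < i < n)%N -> P`_i = 0) -> normc z = 1 ->
  let Q := revpoly n P in
  normc ('X * Q^`()).[z] <= k ^+ mu * normc (Q *+ n - 'X * Q^`()).[z].
Proof.
move=> sP mu0 k0 k1 Pk Pmu z1; cbv zeta; set Q := revpoly n P.
pose x (j : nat) : R := 1 + (- 1) / j.+2%:R.
have x1 j : 0 < x j < 1.
  rewrite /x mulN1r gtrDl oppr_lt0 invr_gt0 ltr0Sn andbT subr_gt0.
  by rewrite invf_lt1// ltr1n.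
have xc : x @ \oo --> (1 : R) by exact: cvg_interpolate.
have pc (p : {poly R[i]}) :
    (fun j => normc p.[(x j)%:C%C * z]) @ \oo --> normc p.[z].
  have c := cont_normc (ccont_horner p (ccont_line z)).
  rewrite -[in X in _ --> X](mul1r z) -(rmorph1 (real_complex R)).
  exact: (@continuous_cvg _ R R \oo _ x _ 1 (c 1) xc).
have kxc : (fun j => k * x j) @ \oo --> k.
  have := @cvgM _ _ \oo _ (fun=> k) x k 1 (@cvg_cst _ _ _ _ _) xc.
  by rewrite mulr1; apply.
have lim : (fun j => (k * x j) ^+ mu
      * normc (Q *+ n - 'X * Q^`()).[(x j)%:C%C * z]) @ \oo -->
    k ^+ mu * normc (Q *+ n - 'X * Q^`()).[z].
  by apply: cvgM; [exact: cvgX_seq|exact: pc].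
apply: (ler_cvg_to (pc ('X * Q^`())) lim); apply: nearW => j.
have /andP[xj0 xj1] := x1 j.
have nx : normc ((x j)%:C%C * z) = x j by rewrite normcM normc_real z1 mulr1 gtr0_norm.
have kx : k * x j < 1 by rewrite (le_lt_trans _ xj1)// ler_piMl// ltW.
by have := reciprocal_schwarz sP mu0 k0 Pk Pmu (z := (x j)%:C%C * z); rewrite nx; apply.
Qed.

(** * The inequality *)

Lemma powR_cvg (R : realType) (u : nat -> R) (l s : R) : 0 < s ->
  (forall n, 0 <= u n) -> 0 <= l -> u @ \oo --> l ->
  (fun n => u n `^ s) @ \oo --> l `^ s.
Proof.
move=> s0 u0 l0 ul; rewrite -[in X in _ --> X](ger0_norm l0).
under eq_fun do rewrite -[u _]ger0_norm//.
apply: (@continuous_cvg _ R R \oo _ u (fun x : R => `|x| `^ s) l) => //.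
exact: powR_norm_continuous.
Qed.

Lemma gt0_powR_inv (R : realType) (x s : R) : 0 < x ->
  x^-1 `^ s = (x `^ s)^-1.
Proof.
move=> x0; have xs : x `^ s != 0 by rewrite gt_eqF ?powR_gt0.
apply: (mulIf xs); rewrite mulVf// -powRM ?invr_ge0 ?(ltW x0)//.
by rewrite mulVf ?gt_eqF// powR1.
Qed.

(** Young's inequality is integrated for $f/x$ and $g/y$. Since [F] or [G] may vanish, the
    normalization uses strictly larger [a] and [b], which then decrease to them. *)
Lemma cint_hoelder (R : realType) (f g : R -> R) (p q : R) :
  0 < p -> 0 < q -> p^-1 + q^-1 = 1 ->
  continuous f -> continuous g -> (forall t, 0 <= f t) -> (forall t, 0 <= g t) ->
  cint (fun t => f t * g t)
  <= cint (fun t => f t `^ p) `^ p^-1 * cint (fun t => g t `^ q) `^ q^-1.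
Proof.
move=> p0 q0 pq cf cg f0 g0.
have cfp := cont_powR p0 f0 cf; have cgq := cont_powR q0 g0 cg.
set F := cint (fun t => f t `^ p); set G := cint (fun t => g t `^ q).
have F0 : 0 <= F by apply: cint_ge0 => t; exact: powR_ge0.
have G0 : 0 <= G by apply: cint_ge0 => t; exact: powR_ge0.
have young a b : F < a -> G < b ->
    cint (fun t => f t * g t) <= a `^ p^-1 * b `^ q^-1.
  move=> Fa Gb; have a0 : 0 < a by exact: le_lt_trans Fa.
  have b0 : 0 < b by exact: le_lt_trans Gb.
  set x := a `^ p^-1; set y := b `^ q^-1.
  have x0 : 0 < x by exact: powR_gt0.
  have y0 : 0 < y by exact: powR_gt0.
  have xp : x `^ p = a by rewrite -powRrM mulVf ?gt_eqF// powRr1// ltW.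
  have yq : y `^ q = b by rewrite -powRrM mulVf ?gt_eqF// powRr1// ltW.
  (* Weights of Young's inequality times $xy$: since $x^p = a$, the term $xy (f/x)^p/p$ is $xy
     f^p/(ap)$, and likewise for $g$. *)
  pose cp := x * y / (a * p); pose cq := x * y / (b * q).
  have cp0 : 0 <= cp by rewrite divr_ge0 ?mulr_ge0// ltW.
  have cq0 : 0 <= cq by rewrite divr_ge0 ?mulr_ge0// ltW.
  have cc (h : R -> R) (c : R) : continuous h -> continuous (fun t => c * h t).
    by move=> ch; apply: cont_mul => // t; exact: cvg_cst.
  apply: (@le_trans _ _ (cint (fun t => cp * f t `^ p + cq * g t `^ q))).
    apply: le_cint; first exact: cont_mul.
      by apply: cont_add; exact: cc.
    move=> t; have := conjugate_powR (divr_ge0 (f0 t) (ltW x0))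
      (divr_ge0 (g0 t) (ltW y0)) p0 q0 pq.
    rewrite !powRM ?invr_ge0 ?f0 ?g0 ?(ltW x0) ?(ltW y0)//.
    rewrite !gt0_powR_inv// xp yq => h.
    have := ler_wpM2l (mulr_ge0 (ltW x0) (ltW y0)) h.
    rewrite (_ : x * y * (f t / x * (g t / y)) = f t * g t); last first.
      by field; rewrite !gt_eqF.
    move=> /le_trans; apply; rewrite le_eqVlt; apply/orP; left; apply/eqP.
    by rewrite /cp /cq; field; rewrite !gt_eqF.
  rewrite cintD; [|exact: cc|exact: cc].
  rewrite !cintZ// -/F -/G.
  have -> : x * y = cp * a + cq * b.
    rewrite -[LHS]mulr1 -pq /cp /cq; field; by rewrite !gt_eqF.
  by rewrite lerD// ler_wpM2l// ltW.
pose e (j : nat) : R := 1 / j.+2%:R.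
have e0 j : 0 < e j by rewrite divr_gt0.
have lim (H s : R) : 0 <= H -> 0 < s ->
    (fun j => (H + e j) `^ s^-1) @ \oo --> H `^ s^-1.
  move=> H0 s0; apply: powR_cvg => //; first by rewrite invr_gt0.
    by move=> j; rewrite addr_ge0// ltW.
  exact: cvg_interpolate.
have L : (fun j => (F + e j) `^ p^-1 * (G + e j) `^ q^-1) @ \oo -->
    F `^ p^-1 * G `^ q^-1 by apply: cvgM; exact: lim.
have cA : (fun _ : nat => cint (fun t => f t * g t)) @ \oo -->
    cint (fun t => f t * g t) by exact: cvg_cst.
apply: (ler_cvg_to cA L); apply: nearW => j.
by apply: young; rewrite ltrDl.
Qed.

(** The bound is uniform on the disk and serves as majorant when the radius tends to 1. *)
Lemma normc_horner_le (R : rcfType) (p : {poly R[i]}) (z : R[i]) :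
  normc z <= 1 -> normc p.[z] <= \sum_(i < size p) normc p`_i.
Proof.
move=> z1; rewrite horner_coef (le_trans (le_normc_sum _ _ _))// ler_sum// => i _.
by rewrite normcM normcX ler_piMr ?normc_ge0// exprn_ile1// normc_ge0.
Qed.

(* The comparison of [1 + A / B] with [1 + tau z] is made on a smaller circle,
   where [B] has no zeros, and the radius then tends to 1. *)
Lemma reciprocal_norm_le (R : realType) n mu (P : {poly R[i]}) (k r p q : R) :
  size P = n.+1 -> (0 < mu <= n)%N -> 0 <= k -> k <= 1 ->
  (forall b, root P b -> normc b <= k) ->
  (forall i, (n - mu < i < n)%N -> P`_i = 0) ->
  0 < r -> 0 < p -> 0 < q -> p^-1 + q^-1 = 1 ->
  n%:R `^ r * cint (fun t => normc (revpoly n P).[expi t] `^ r)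
  <= cint (fun t => normc (1 + (k ^+ mu)%:C%C * expi t) `^ (p * r)) `^ p^-1
   * cint (fun t => normc (revpoly n P *+ n - 'X * (revpoly n P)^`()).[expi t]
                      `^ (q * r)) `^ q^-1.
Proof.
move=> sP mun k0 k1 Pk Pmu r0 p0 q0 pq.
set Q := revpoly n P; set A := 'X * Q^`(); set B := Q *+ n - A.
have /andP[mu0 mu_n] := mun; have n0 : (0 < n)%N by exact: leq_trans mu_n.
have pr0 : 0 < p * r by exact: mulr_gt0.
have qr0 : 0 < q * r by exact: mulr_gt0.
have ce := ccont_expi R; have ne := @normc_expi R.
pose x (j : nat) : R := 1 + (- 1) / j.+2%:R.
have x1 j : 0 < x j < 1.
  rewrite /x mulN1r gtrDl oppr_lt0 invr_gt0 ltr0Sn andbT subr_gt0.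
  by rewrite invf_lt1// ltr1n.
have xc : x @ \oo --> (1 : R) by exact: cvg_interpolate.
have kx j : k * x j < 1.
  by have /andP[? xj1] := x1 j; rewrite (le_lt_trans _ xj1)// ler_piMl// ltW.
have kx0 j : 0 <= k * x j by have /andP[/ltW ? _] := x1 j; exact: mulr_ge0.
have nx j z : normc ((x j)%:C%C * z) = x j * normc z.
  by have /andP[/ltW ? _] := x1 j; rewrite normcM normc_real ger0_norm.
have cx j : ccont (fun t => (x j)%:C%C * expi t).
  by apply: ccontM => //; exact: ccont_cst.
have step j :
    n%:R `^ r * cint (fun t => normc Q.[(x j)%:C%C * expi t] `^ r)
    <= cint (fun t => normc (1 + ((k * x j) ^+ mu)%:C%C * expi t) `^ (p * r)) `^ p^-1
     * cint (fun t => normc B.[(x j)%:C%C * expi t] `^ (q * r)) `^ q^-1.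
  have /andP[xj0 xj1] := x1 j.
  (* Composing with this dilation turns the circle of radius [x j] into the unit circle and makes
     $B$ zero-free on the closed disk. *)
  pose S : {poly R[i]} := (x j)%:C%C *: 'X.
  have SE z : S.[z] = (x j)%:C%C * z by rewrite hornerZ hornerX.
  have S1 z : normc z <= 1 -> k * normc S.[z] < 1.
    move=> z1; rewrite SE nx (le_lt_trans _ (kx j))// ler_wpM2l//.
    by rewrite ler_piMr// ltW.
  have B0 z : normc z <= 1 -> (B \Po S).[z] != 0.
    move=> z1; rewrite horner_comp.
    have [] // := @reciprocal_dominates _ n P S.[z] sP n0.
    move=> b /Pk bk; rewrite normcM (le_lt_trans _ (S1 _ z1))//.
    by rewrite ler_wpM2r ?normc_ge0.
  have AB z : normc z = 1 ->
      normc (A \Po S).[z] <= (k * x j) ^+ mu * normc (B \Po S).[z].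
    move=> z1; have Sz : normc S.[z] = x j by rewrite SE nx z1 mulr1.
    have := @reciprocal_schwarz _ n mu P k sP mun k0 Pk Pmu S.[z].
    by rewrite Sz !horner_comp; apply.
  have A0 : (A \Po S)`_0 = 0.
    by rewrite -horner_coef0 horner_comp SE mulr0 hornerM hornerX mul0r.
  have t1 : (k * x j) ^+ mu < 1 by rewrite exprn_ilt1// -lt0n.
  have sub := cint_powR_subordinate_rational B0 A0 (exprn_ge0 mu (kx0 j)) t1 pr0 AB.
  (* Since $A + B = nQ$, the product of [f] and [g] is $|nQ|^r$ on the smaller circle; these are the
     two factors for Hoelder's inequality. *)
  pose f t := (normc ((B \Po S) + (A \Po S)).[expi t] / normc (B \Po S).[expi t]) `^ r.
  pose g t := normc (B \Po S).[expi t] `^ r.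
  have Bt t : normc (B \Po S).[expi t] != 0 by rewrite normc_eq0 B0// ne.
  have cB := cont_normc (ccont_horner (B \Po S) ce).
  have f0 t : 0 <= f t by exact: powR_ge0.
  have g0 t : 0 <= g t by exact: powR_ge0.
  have cf : continuous f.
    apply: cont_powR => //; first by move=> t; rewrite divr_ge0// normc_ge0.
    apply: cont_mul; first exact/cont_normc/ccont_horner.
    by move=> t; apply: cvgV => //; exact: cB.
  have cg : continuous g by apply: cont_powR => // t; exact: normc_ge0.
  have := cint_hoelder p0 q0 pq cf cg f0 g0.
  have -> : cint (fun t => f t * g t)
      = n%:R `^ r * cint (fun t => normc Q.[(x j)%:C%C * expi t] `^ r).
    rewrite -cintZ; last first.
      apply: cont_powR => // [t|]; first exact: normc_ge0.
      exact/cont_normc/ccont_horner.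
    apply: eq_cint => t; rewrite /f /g -!powRM ?divr_ge0 ?normc_ge0//.
    rewrite divfK// -normc_nat -normcM; congr (normc _ `^ _).
    by rewrite hornerD !horner_comp -hornerD subrK hornerMn SE mulr_natl.
  move=> /le_trans; apply.
  have ge0 (h : R -> R) s1 : 0 <= cint (fun t => h t `^ s1).
    by apply: cint_ge0 => t; exact: powR_ge0.
  have fE : cint (fun t => f t `^ p) = cint (fun t =>
      (normc ((B \Po S) + (A \Po S)).[expi t] / normc (B \Po S).[expi t]) `^ (p * r)).
    by apply: eq_cint => t; rewrite /f -powRrM [r * p]mulrC.
  have gE : cint (fun t => g t `^ q)
      = cint (fun t => normc B.[(x j)%:C%C * expi t] `^ (q * r)).
    by apply: eq_cint => t; rewrite /g -powRrM [r * q]mulrC horner_comp SE.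
  rewrite gE; apply: ler_wpM2r; first exact: powR_ge0.
  by apply: ge0_ler_powR; rewrite ?nnegrE ?invr_ge0 ?(ltW p0) ?ge0// fE.
have lim (P1 : {poly R[i]}) s : 0 < s ->
    (fun j => cint (fun t => normc P1.[(x j)%:C%C * expi t] `^ s)) @ \oo -->
    cint (fun t => normc P1.[expi t] `^ s).
  move=> s0; apply: (@cint_powR_cvg _ _ _ _ (\sum_(i < size P1) normc P1`_i)) => //.
  - by move=> j; exact/cont_normc/ccont_horner.
  - exact/cont_normc/ccont_horner.
  - move=> j t; rewrite normc_ge0 normc_horner_le// nx ne mulr1.
    by have /andP[_ /ltW] := x1 j.
  - by move=> t; exact: normc_ge0.
  - move=> t; have c := cont_normc (ccont_horner P1 (ccont_line (expi t))).
    rewrite -[in X in _ --> X](mul1r (expi t)) -(rmorph1 (real_complex R)).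
    exact: (@continuous_cvg _ R R \oo _ x _ 1 (c 1) xc).
have lim1 : (fun j => cint (fun t =>
      normc (1 + ((k * x j) ^+ mu)%:C%C * expi t) `^ (p * r))) @ \oo -->
    cint (fun t => normc (1 + (k ^+ mu)%:C%C * expi t) `^ (p * r)).
  have cl (a : R) : continuous (fun t => normc (1 + a%:C%C * expi t)).
    by apply: cont_normc; apply: ccontD; [|apply: ccontM => //]; exact: ccont_cst.
  apply: (@cint_powR_cvg _ _ _ _ 2) => //.
  - move=> j t; rewrite normc_ge0 andTb (le_trans (le_normcD _ _))// normc1.
    rewrite normcM ne normc_real ger0_norm ?exprn_ge0// mulr1.
    by have : (k * x j) ^+ mu <= 1 by [rewrite exprn_ile1// ltW]; lra.
  - by move=> t; exact: normc_ge0.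
  - move=> t; have c : continuous (fun a : R => normc (1 + a%:C%C * expi t)).
      by apply: cont_normc; apply: ccontD; [exact: ccont_cst|exact: ccont_line].
    apply: (@continuous_cvg _ R R \oo _ (fun j => (k * x j) ^+ mu) _ _ (c (k ^+ mu))).
    apply: cvgX_seq; have := @cvgM _ _ \oo _ (fun=> k) x k 1 (@cvg_cst _ _ _ _ _) xc.
    by rewrite mulr1; apply.
have pw (u : nat -> R -> R) (v : R -> R) s a : 0 < s ->
    (fun j => cint (fun t => u j t `^ a)) @ \oo --> cint (fun t => v t `^ a) ->
    (fun j => cint (fun t => u j t `^ a) `^ s^-1) @ \oo -->
    cint (fun t => v t `^ a) `^ s^-1.
  move=> s0; apply: powR_cvg; first by rewrite invr_gt0.
    by move=> j; apply: cint_ge0 => t; exact: powR_ge0.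
  by apply: cint_ge0 => t; exact: powR_ge0.
have cL : (fun j => n%:R `^ r * cint (fun t => normc Q.[(x j)%:C%C * expi t] `^ r))
    @ \oo --> n%:R `^ r * cint (fun t => normc Q.[expi t] `^ r).
  by apply: cvgM; [exact: cvg_cst|exact: lim].
have cR := cvgM (pw _ _ _ _ p0 lim1) (pw _ _ _ _ q0 (lim B _ qr0)).
by apply: (ler_cvg_to cL (cR _)); apply: nearW => j; exact: step.
Qed.

Lemma powR_root_le (R : realType) (x a b c r p q : R) : 0 <= x -> 0 <= a ->
  0 < r -> x `^ r * a <= b `^ p^-1 * c `^ q^-1 ->
  x * a `^ r^-1 <= b `^ (p * r)^-1 * c `^ (q * r)^-1.
Proof.
move=> x0 a0 r0 h; have ri0 : 0 <= r^-1 by rewrite invr_ge0 ltW.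
have l0 : 0 <= x `^ r * a by rewrite mulr_ge0// powR_ge0.
have := ge0_ler_powR ri0 _ _ h; rewrite !nnegrE l0 (le_trans l0 h).
rewrite !powRM ?powR_ge0// -!powRrM -!invfM mulfV ?gt_eqF// powRr1//.
exact.
Qed.

Theorem theorem1p8 (R : realType) (n mu : nat) (a : nat -> R[i])
    (P : {poly R[i]}) (k : R)
    (hmu : (1 <= mu <= n)%N)
    (hP : P = a n *: 'X^n + \sum_(mu <= nu < n.+1) a (n - nu)%N *: 'X^(n - nu))
    (hdeg : size P = n.+1)
    (hk : k <= 1)
    (hroots : forall z : R[i], root P z -> normc z <= k)
    (alpha : R[i]) (halpha : k ^+ mu <= normc alpha)
    (r p q : R) (hr : 0 < r) (hp : 1 < p) (hq : 1 < q)
    (hpq : p^-1 + q^-1 = 1) :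
  n%:R * (normc alpha - k ^+ mu) * circle_norm r (fun z => P.[z])
  <= circle_norm (p * r) (fun z => 1 + (k ^+ mu)%:C%C * z)
     * circle_norm (q * r) (fun z => (polar_deriv alpha P).[z]).
Proof.
have p0 : 0 < p by rewrite (lt_trans _ hp).
have q0 : 0 < q by rewrite (lt_trans _ hq).
have qr0 : 0 < q * r by exact: mulr_gt0.
have n0 : (0 < n)%N by case/andP: hmu => /leq_trans; apply.
(* As $n > 0$, [P] has a root, whose modulus is at most [k]. *)
have k0 : 0 <= k.
  have /closed_rootP[z] : size P != 1%N by rewrite hdeg eqSS -lt0n.
  by move/hroots; apply: le_trans; exact: normc_ge0.
(* Apart from the top term, the exponents $n - \nu$ with $\nu \ge \mu$ do not exceed $n - \mu$. *)
have Pmu i : (n - mu < i < n)%N -> P`_i = 0.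
  move=> /andP[mui ni]; rewrite hP coefD coefZ coefXn (ltn_eqF ni) mulr0 add0r.
  rewrite coef_sum big_nat big1// => nu /andP[munu nun].
  by rewrite coefZ coefXn gtn_eqF ?mulr0//; lia.
set d := normc alpha - k ^+ mu.
have d0 : 0 <= d by rewrite subr_ge0.
set Q := revpoly n P; set A := 'X * Q^`(); set B := Q *+ n - A.
have sX : (size ('X * P^`())%R <= n.+1)%N.
  by rewrite (leq_trans (size_polyMleq _ _))// size_polyX /= -hdeg lt_size_deriv// -size_poly_gt0 hdeg.
have sD : (size (P *+ n - 'X * P^`())%R <= n.+1)%N.
  rewrite (leq_trans (size_polyD _ _))// geq_max size_polyN sX andbT.
  by rewrite -scaler_nat (leq_trans (size_scale_leq _ _))// hdeg.
have onc t : expi t * (expi t)^*%C = 1 :> R[i] by rewrite mulc_conj_unit// normc_expi.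
have Qt t : normc Q.[expi t] = normc P.[expi t].
  by rewrite horner_revpoly ?hdeg// normcM normcX normc_expi expr1n mul1r normc_conj.
have At t : normc A.[expi t] = normc (P *+ n - 'X * P^`()).[expi t].
  rewrite /A mulX_deriv_revpoly ?hdeg// horner_revpoly//.
  by rewrite normcM normcX normc_expi expr1n mul1r normc_conj.
(* $B$ is the reversal of $nP - (nP - zP') = zP'$. *)
have Bt t : normc B.[expi t] = normc P^`().[expi t].
  have -> : B.[expi t] = expi t ^+ n * (('X * P^`()).[expi t])^*%C.
    rewrite /B /A mulX_deriv_revpoly ?hdeg// hornerD hornerN hornerMn.
    rewrite !horner_revpoly ?hdeg// hornerD hornerN hornerMn rmorphB rmorphMn.
    by rewrite mulrBr mulrnAr subKr.
  by rewrite normcM normcX normc_expi expr1n mul1r normc_conj hornerM hornerX normcM normc_expi mul1r.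
(* $D_\alpha P = \alpha P' + (nP - zP')$, where the two parts have moduli $|\alpha||B|$ and $|A| \le
   k^\mu |B|$ on the circle. *)
have Dt t : d * normc B.[expi t] <= normc (polar_deriv alpha P).[expi t].
  have := reciprocal_circle_le hdeg hmu k0 hk hroots Pmu (normc_expi t).
  cbv zeta; rewrite -/Q -/A -/B At.
  have -> : (polar_deriv alpha P).[expi t]
      = alpha * P^`().[expi t] - - (P *+ n - 'X * P^`()).[expi t].
    rewrite /polar_deriv hdeg /= !hornerE; ring.
  move=> h; rewrite (le_trans _ (le_normc_sub _ _))// normcN normcM -Bt mulrBl.
  by rewrite lerD2l lerN2.
have cB : continuous (fun t => normc B.[expi t]).
  exact/cont_normc/ccont_horner/ccont_expi.
have main := reciprocal_norm_le hdeg hmu k0 hk hroots Pmu hr p0 q0 hpq.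
rewrite -/Q -/A -/B in main.
have pw0 (f : R -> R) s : 0 <= cint (fun t => f t `^ s).
  by apply: cint_ge0 => t; exact: powR_ge0.
have scale : d * cint (fun t => normc B.[expi t] `^ (q * r)) `^ (q * r)^-1
    <= circle_norm (q * r) (fun z => (polar_deriv alpha P).[z]).
  (* Writing [d] as $(d^{qr})^{1/(qr)}$ brings it under the integral. *)
  rewrite -[d in leLHS]powRr1// -(mulfV (lt0r_neq0 qr0)) powRrM.
  rewrite -powRM ?powR_ge0// -cintZ; last by apply: cont_powR => // t; exact: normc_ge0.
  apply: ge0_ler_powR; rewrite ?nnegrE ?invr_ge0 ?(ltW qr0)//.
  - by apply: cint_ge0 => t; rewrite mulr_ge0// powR_ge0.
  - exact: pw0.
  apply: le_cint.
  - apply: cont_mul; first by move=> t; exact: cvg_cst.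
    by apply: cont_powR => // t; exact: normc_ge0.
  - apply: cont_powR => // [t|]; first exact: normc_ge0.
    exact/cont_normc/ccont_horner/ccont_expi.
  - move=> t; rewrite -powRM ?normc_ge0//; apply: ge0_ler_powR => //.
    + exact: ltW.
    + by rewrite nnegrE mulr_ge0// normc_ge0.
    + by rewrite nnegrE normc_ge0.
have root_main : n%:R * circle_norm r (fun z => P.[z])
    <= circle_norm (p * r) (fun z => 1 + (k ^+ mu)%:C%C * z)
     * cint (fun t => normc B.[expi t] `^ (q * r)) `^ (q * r)^-1.
  rewrite (eq_cint (fun t => congr1 (fun y => y `^ r) (Qt t))) in main.
  by apply: powR_root_le main => //; exact: pw0.
rewrite mulrAC mulrC; apply: (le_trans (ler_wpM2l d0 root_main)).
by rewrite mulrCA; apply: ler_wpM2l; [exact: powR_ge0|exact: scale].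
Qed.
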